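(* Let $G$ be a finite group and let $\underline{S}^{-1}\underline{A}$ be obtained from the Burnside functor $\underline{A}$ by inverting $[G/e]\in\underline{A}(G/G)$. For any indexing category $\mathcal{O}$ for $G$ and any subgroup $H\le G$, the free $\mathcal{O}$-Tambara functor $\underline{S}^{-1}\underline{A}^{\mathcal{O}}[x_{G/H}]$ is free as an $\underline{S}^{-1}\underline{A}$-module.
   Context: $\mathrm{Set}^G$ is the category of finite $G$-sets. An indexing category for $G$ is a subcategory $\mathcal{O}\subseteq\mathrm{Set}^G$ which is wide (contains all objects), pullback stable (if $f\colon A\to C$ is the pullback in $\mathrm{Set}^G$ of a morphism $g\colon B\to D$ of $\mathcal{O}$ along any map $C\to D$, then $f\in\mathcal{O}$) and finite coproduct complete (it has all finite coproducts, created in $\mathrm{Set}^G$). Polynomials: $\mathcal{P}^G_{\mathcal{O}}$ has finite $G$-sets as objects; a morphism $X\to Y$ is an isomorphism class of diagrams $[X\xleftarrow{f}A\xrightarrow{g}B\xrightarrow{h}Y]$ of finite $G$-sets with $g\in\mathcal{O}$ (isomorphisms are compatible isomorphisms $A\cong A'$, $B\cong B'$ over $X$ and $Y$). Such a morphism is $T_h\circ N_g\circ R_f$, where $R_f=[X\xleftarrow{f}A=A=A]$, $N_g=[A=A\xrightarrow{g}B=B]$, $T_h=[B=B=B\xrightarrow{h}Y]$. Composition is determined by: $R$ is contravariantly functorial, $N$ and $T$ are covariantly functorial; for a pullback square with $f\colon X\to Y$, $g\colon Y'\to Y$ and base changes $f'\colon X'\to Y'$, $g'\colon X'\to X$, one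 has $R_gN_f=N_{f'}R_{g'}$ and $R_gT_f=T_{f'}R_{g'}$; and for $g\colon A\to S$, $h\colon S\to T$, $N_hT_g=T_{h'}N_{g'}R_{f'}$, where $\Pi_h$ is the right adjoint of pullback $h^*\colon\mathrm{Set}^G_{/T}\to\mathrm{Set}^G_{/S}$, $h'\colon\Pi_hA\to T$ is the structure map, $g'\colon S\times_T\Pi_hA\to\Pi_hA$ the projection and $f'\colon S\times_T\Pi_hA\to A$ the counit. Disjoint union is the categorical product in $\mathcal{P}^G_{\mathcal{O}}$. Each $\mathcal{P}^G_{\mathcal{O}}(X,Y)$ is a commutative semiring, with addition given by disjoint union of $A$'s and $B$'s; $(-)^+$ denotes additive group completion. An $\mathcal{O}$-Tambara functor is a product-preserving functor $\underline{R}\colon\mathcal{P}^G_{\mathcal{O}}\to\mathrm{Set}$ such that every $\underline{R}(X)$ is an abelian group; then each $\underline{R}(X)$ is a commutative ring. For a finite $G$-set $T$, $\underline{A}^{\mathcal{O}}[x_T]:=\mathcal{P}^G_{\mathcal{O}}(T,-)^+$. Mackey functors: the Burnside category $\mathcal{A}^G$ has finite $G$-sets as objects and $\mathcal{A}^G(X,Y)$ is the group completion (under disjoint union) of isomorphism classes of spans $X\leftarrow S\to Y$, composed by pullback. A Mackey functor is an additive functor $\mathcal{A}^G\to\mathrm{Ab}$. The underlying Mackey functor of an $\mathcal{O}$-Tambara functor keeps only restrictions and transfers. The box product $\boxtimes$ is Day convolution built from the Cartesian product of finite $G$-sets and $\otimes_{\mathbb{Z}}$. The box product of $\mathcal{O}$-Tambara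 functors is again an $\mathcal{O}$-Tambara functor (the coproduct). A Green functor is a commutative monoid for $\boxtimes$ (equivalently, an $\mathcal{O}^{\mathrm{triv}}$-Tambara functor, where $\mathcal{O}^{\mathrm{triv}}$ consists of the stabilizer-preserving maps); every $\mathcal{O}$-Tambara functor has an underlying Green functor, and a module over it is a Mackey functor with a unital associative action $\underline{R}\boxtimes\underline{M}\to\underline{M}$. The Burnside functor $\underline{A}$ is the unit for $\boxtimes$ and the initial $\mathcal{O}$-Tambara functor; $\underline{A}(X)$ is the additive group completion of the semiring of isomorphism classes of finite $G$-sets over $X$, so $\underline{A}(G/H)$ is the Burnside ring of $H$. Localization: $\underline{A}\to\underline{S}^{-1}\underline{A}$ is the initial map of $\mathcal{O}$-Tambara functors out of $\underline{A}$ that sends $[G/e]\in\underline{A}(G/G)$ to a unit. The free $\underline{S}^{-1}\underline{A}$-algebra on a generator at level $G/H$ is $\underline{S}^{-1}\underline{A}^{\mathcal{O}}[x_{G/H}]:=\underline{S}^{-1}\underline{A}\boxtimes\underline{A}^{\mathcal{O}}[x_{G/H}]$. For a Green functor $\underline{R}$, an $\underline{R}$-module is free if it is isomorphic to $\bigoplus_{i\in I}\underline{R}\{x_{T_i}\}$ for finite $G$-sets $T_i$, where $\underline{R}\{x_T\}:=\underline{R}\boxtimes\mathcal{A}^G(T,-)$. *)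

(* Defs.v *)
From mathcomp Require Import all_boot all_order all_fingroup all_algebra.

Set Implicit Arguments.
Unset Strict Implicit.
Unset Printing Implicit Defensive.

Import GRing.Theory.
Local Open Scope ring_scope.

Reserved Notation "x <* a" (at level 40, left associativity).

Section FiniteGSets.
Variable G : finGroupType.

(* Group elements act on the right, as everywhere in MathComp; g.x := x <* g^-1
   identifies these objects with left G-sets. *)
Record gset := GSet { gcar :> finType; gact : {action G &-> gcar} }.

Definition gop (X : gset) (x : X) (a : G) : X := gact X x a.
Local Notation "x <* a" := (gop x a).

Lemma gop1 (X : gset) (x : X) : x <* 1%g = x. Proof. exact: act1. Qed.
Lemma gopM (X : gset) (x : X) a b : x <* (a * b)%g = x <* a <* b.
Proof. exact: actM. Qed.

Record gmap (X Y : gset) :=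
  GMap { gfun :> X -> Y; gmapJ : forall x a, gfun (x <* a) = gfun x <* a }.

Definition gid (X : gset) : gmap X X := @GMap X X id (fun _ _ => erefl).

Lemma gcompJ (X Y Z : gset) (g : gmap Y Z) (f : gmap X Y) x a :
  (g \o f) (x <* a) = (g \o f) x <* a.
Proof. by rewrite /= !gmapJ. Qed.
Definition gcomp (X Y Z : gset) (g : gmap Y Z) (f : gmap X Y) : gmap X Z :=
  GMap (gcompJ g f).

(* The one-point set G/G. *)
Definition pointg : gset :=
  GSet (TotalAction (to := fun (x : unit) (_ : G) => x)
          (fun _ => erefl) (fun _ _ _ => erefl)).
Definition emptyg : gset :=
  GSet (TotalAction (to := fun (x : void) (_ : G) => x)
          (fun _ => erefl) (fun _ _ _ => erefl)).
Definition to_point (X : gset) : gmap X pointg :=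
  @GMap X pointg (fun _ => tt) (fun _ _ => erefl).
Definition from_empty (X : gset) : gmap emptyg X :=
  @GMap emptyg X (of_void X) (fun x => match x with end).

Section Orbit.
Variable H : {group G}.
Definition coset_type := {C : {set G} | C \in rcosets H [set: G]}.
Lemma coset_actP (C : coset_type) a :
  (val C :* a)%g \in rcosets H [set: G].
Proof.
case: C => C /= /rcosetsP[x _ ->]; rewrite -rcosetM; apply/rcosetsP.
by exists (x * a)%g; rewrite ?inE.
Qed.
Definition coset_act (C : coset_type) a : coset_type :=
  exist _ (val C :* a)%g (coset_actP C a).
Lemma coset_act1 : coset_act^~ 1%g =1 id.
Proof. by move=> C; apply: val_inj; rewrite /= rcoset1. Qed.
Lemma coset_actM C : act_morph coset_act C.
Proof. by move=> a b; apply: val_inj; rewrite /= rcosetM. Qed.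
(* The transitive G-set G/H. *)
Definition orbitg : gset := GSet (TotalAction coset_act1 coset_actM).
End Orbit.

Section Product.
Variables X Y : gset.
Definition prod_act (z : X * Y) a := (z.1 <* a, z.2 <* a).
Lemma prod_act1 : prod_act^~ 1%g =1 id.
Proof. by case=> x y; rewrite /prod_act !gop1. Qed.
Lemma prod_actM z : act_morph prod_act z.
Proof. by move=> a b; rewrite /prod_act !gopM. Qed.
Definition prodg : gset := GSet (TotalAction prod_act1 prod_actM).
Definition gfst : gmap prodg X := @GMap prodg X fst (fun _ _ => erefl).
Definition gsnd : gmap prodg Y := @GMap prodg Y snd (fun _ _ => erefl).
End Product.

Definition gpair (Z X Y : gset) (f : gmap Z X) (g : gmap Z Y) :
  gmap Z (prodg X Y).
Proof.
by exists (fun z => (f z, g z)) => z a; rewrite !gmapJ.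
Defined.

Definition prod_gmap (X X' Y Y' : gset) (f : gmap X X') (g : gmap Y Y') :
    gmap (prodg X Y) (prodg X' Y') :=
  gpair (gcomp f (gfst X Y)) (gcomp g (gsnd X Y)).

Section Sum.
Variables X Y : gset.
Definition sum_act (z : X + Y) a : X + Y :=
  match z with inl x => inl (x <* a) | inr y => inr (y <* a) end.
Lemma sum_act1 : sum_act^~ 1%g =1 id.
Proof. by case=> x /=; rewrite gop1. Qed.
Lemma sum_actM z : act_morph sum_act z.
Proof. by move=> a b; case: z => x /=; rewrite gopM. Qed.
Definition sumg : gset := GSet (TotalAction sum_act1 sum_actM).
Definition ginl : gmap X sumg := @GMap X sumg inl (fun _ _ => erefl).
Definition ginr : gmap Y sumg := @GMap Y sumg inr (fun _ _ => erefl).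
End Sum.

Definition gcopair (X Y Z : gset) (f : gmap X Z) (g : gmap Y Z) :
  gmap (sumg X Y) Z.
Proof.
exists (fun z : X + Y => match z with inl x => f x | inr y => g y end).
by case=> x a; rewrite /= -gmapJ.
Defined.

Definition gfold (X : gset) : gmap (sumg X X) X := gcopair (gid X) (gid X).

Definition sum_gmap (X X' Y Y' : gset) (f : gmap X X') (g : gmap Y Y') :
    gmap (sumg X Y) (sumg X' Y') :=
  gcopair (gcomp (ginl X' Y') f) (gcomp (ginr X' Y') g).

Section Subset.
Variables (X : gset) (P : pred X) (PJ : forall x a, P x -> P (x <* a)).
Definition sub_act (x : {x : X | P x}) a : {x : X | P x} :=
  exist _ (val x <* a) (PJ a (valP x)).
Lemma sub_act1 : sub_act^~ 1%g =1 id.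
Proof. by move=> x; apply: val_inj; rewrite /= gop1. Qed.
Lemma sub_actM x : act_morph sub_act x.
Proof. by move=> a b; apply: val_inj; rewrite /= gopM. Qed.
Definition subg : gset := GSet (TotalAction sub_act1 sub_actM).
Definition subg_val : gmap subg X := @GMap subg X val (fun _ _ => erefl).
End Subset.

Section Subsets.
Variable X : gset.
Definition pow_act (S : {set X}) a : {set X} := [set x <* a | x in S].
Lemma pow_act1 : pow_act^~ 1%g =1 id.
Proof.
by move=> S; rewrite /pow_act (eq_imset _ (@gop1 X)) imset_id.
Qed.
Lemma pow_actM S : act_morph pow_act S.
Proof.
by move=> a b; rewrite /pow_act -imset_comp; apply: eq_imset => x; exact: gopM.
Qed.
Definition powg : gset := GSet (TotalAction pow_act1 pow_actM).
End Subsets.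

(* The square
      A --k--> B
      |f       |g
      v        v
      C --h--> D
   is a pullback in the category of finite G-sets. *)
Definition is_pullback (A B C D : gset)
    (f : gmap A C) (k : gmap A B) (g : gmap B D) (h : gmap C D) : Prop :=
  (forall a, h (f a) = g (k a)) /\
  forall (U : gset) (u : gmap U C) (v : gmap U B),
    (forall x, h (u x) = g (v x)) ->
    exists w : gmap U A,
      [/\ forall x, f (w x) = u x, forall x, k (w x) = v x &
          forall w' : gmap U A, (forall x, f (w' x) = u x) ->
            (forall x, k (w' x) = v x) -> w' =1 w].

Section Pullback.
Variables (X Y Z : gset) (f : gmap X Z) (g : gmap Y Z).
Definition pb_pred (z : prodg X Y) := f z.1 == g z.2.
Lemma pb_predJ z a : pb_pred z -> pb_pred (z <* a).
Proof. by rewrite /pb_pred /= !gmapJ => /eqP->. Qed.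
Definition pb : gset := subg pb_predJ.
Definition pb1 : gmap pb X := gcomp (gfst X Y) (subg_val pb_predJ).
Definition pb2 : gmap pb Y := gcomp (gsnd X Y) (subg_val pb_predJ).
Definition pb_elt x y (e : f x = g y) : pb :=
  exist _ (x, y) (introT eqP e).

Lemma pbE (z : pb) : f (pb1 z) = g (pb2 z).
Proof. by case: z => [[x y] /= /eqP]. Qed.

Lemma pb_inj (z w : pb) : pb1 z = pb1 w -> pb2 z = pb2 w -> z = w.
Proof.
by case: z w => [[x y] i] [[x' y'] j] /= e1 e2; apply: val_inj; rewrite /= e1 e2.
Qed.

Definition pb_lift (U : gset) (u : gmap U X) (v : gmap U Y)
  (e : forall x, f (u x) = g (v x)) : gmap U pb.
Proof.
by exists (fun x => pb_elt (e x)) => x a; apply: pb_inj; rewrite /= !gmapJ.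
Defined.

Lemma pb_is_pullback : is_pullback pb1 pb2 g f.
Proof.
split=> [z|U u v e]; first exact: pbE.
exists (pb_lift e); split=> // w' e1 e2 x.
by apply: pb_inj; rewrite ?e1 ?e2.
Qed.
End Pullback.
Arguments pb1 {X Y Z f g}.
Arguments pb2 {X Y Z f g}.
Arguments pb_inj {X Y Z f g} z w.

(* Pi_l of an object p : B -> C over C, for l : C -> D: a point is some d : D
   with a section s of p over the fibre of l at d; s is encoded by its image, a
   subset of B meeting each fibre p^-1(c), l(c) = d, in one point and
   contained in their union. *)
Section DependentProduct.
Variables (B C D : gset) (p : gmap B C) (l : gmap C D).
Definition pi_pred (z : prodg D (powg B)) :=
  [forall b in z.2, l (p b) == z.1] &&
  [forall c, (l c == z.1) ==> (#|[set b in z.2 | p b == c]| == 1)%N].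

Lemma gop_inj (X : gset) a : injective (fun x : X => x <* a).
Proof. exact: act_inj. Qed.
Lemma gopK (X : gset) (x : X) a : x <* a <* a^-1%g = x.
Proof. by rewrite -gopM mulgV gop1. Qed.
Lemma gopVK (X : gset) (x : X) a : x <* a^-1%g <* a = x.
Proof. by rewrite -gopM mulVg gop1. Qed.

Lemma pi_predJ z a : pi_pred z -> pi_pred (z <* a).
Proof.
case: z => d s; rewrite /pi_pred => /andP[/forall_inP h1 /forallP h2]; apply/andP; split.
  apply/forall_inP => _ /imsetP[b bs ->] /=.
  by rewrite !gmapJ (eqP (h1 b bs)).
apply/forallP => c; apply/implyP => /= /eqP lc.
have /implyP := h2 (c <* a^-1%g).
rewrite gmapJ lc /= gopK eqxx => /(_ isT) /eqP.
rewrite -(card_imset _ (@gop_inj B a)) => h; rewrite -{}[in X in _ == X]h.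
apply/eqP/eq_card => b; rewrite !inE; apply/andP/imsetP => [[/imsetP[b' b's ->] /eqP <-]|].
  by exists b' => //; rewrite inE b's -gmapJ gopK /=.
case=> b'; rewrite inE => /andP[b's /eqP e] ->.
rewrite gmapJ e gopVK; split=> //; exact: (imset_f (fun x : B => x <* a)).
Qed.

Definition pi : gset := subg pi_predJ.
Definition pi_str : gmap pi D := gcomp (gfst D (powg B)) (subg_val pi_predJ).
Definition pi_sec : gmap pi (powg B) :=
  gcomp (gsnd D (powg B)) (subg_val pi_predJ).

Lemma pi_secP (z : pi) b : b \in (pi_sec z : {set B}) -> l (p b) = pi_str z.
Proof.
case: z => [[d s] hz] /=; have /andP[/forall_inP h _] := hz.
by move=> /h /eqP.
Qed.

Lemma pi_sec_ex (z : pi) c : l c = pi_str z ->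
  exists b, (b \in (pi_sec z : {set B})) && (p b == c).
Proof.
case: z => [[d s] hz] /=; have /andP[_ /forallP /(_ c) /=] := hz.
move=> + e; rewrite e eqxx => /cards1P[b /setP /(_ b)].
by rewrite !inE eqxx => h; exists b.
Qed.

Lemma pi_uniq (z : pi) b b' : b \in (pi_sec z : {set B}) ->
  b' \in (pi_sec z : {set B}) -> p b = p b' -> b = b'.
Proof.
move=> bz b'z e; have := pi_secP bz.
case: z bz b'z => [[d s] hz] /= bs b's lb.
have /andP[_ /forallP /(_ (p b)) /=] := hz.
rewrite lb eqxx => /cards1P[b0 /setP e0].
have /eqP-> : b == b0 by move: (e0 b); rewrite !inE bs eqxx.
by move: (e0 b'); rewrite !inE b's -e eqxx => /esym/eqP.
Qed.

Lemma pi_ext (z w : pi) : pi_str z = pi_str w ->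
  (forall b, b \in (pi_sec z : {set B}) -> b \in (pi_sec w : {set B})) ->
  z = w.
Proof.
move=> e h; apply: val_inj.
suff e' : pi_sec z = pi_sec w :> {set B}.
  by case: z w e e' {h} => [[? ?] ?] [[? ?] ?] /= -> ->.
apply/setP => b; apply/idP/idP => [|bw]; first exact: h.
have [b' /andP[b'z /eqP e']] : exists b', (b' \in (pi_sec z : {set B})) && (p b' == p b).
  by apply: pi_sec_ex; rewrite (pi_secP bw).
by rewrite (pi_uniq bw (h _ b'z) (esym e')).
Qed.

(* The counit C x_D Pi_l B -> B, (c, (d, s)) |-> s(c). *)
Lemma pi_ev_ex (z : pb l pi_str) :
  exists b, (b \in (pi_sec (pb2 z) : {set B})) && (p b == pb1 z).
Proof. by apply: pi_sec_ex; rewrite pbE. Qed.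
Definition pi_ev_fun (z : pb l pi_str) : B := xchoose (pi_ev_ex z).

Lemma pi_ev_in z : pi_ev_fun z \in (pi_sec (pb2 z) : {set B}).
Proof. by have /andP[] := xchooseP (pi_ev_ex z). Qed.
Lemma pi_ev_over z : p (pi_ev_fun z) = pb1 z.
Proof. by have /andP[_ /eqP] := xchooseP (pi_ev_ex z). Qed.

Lemma pi_evJ z a : pi_ev_fun (z <* a) = pi_ev_fun z <* a.
Proof.
apply: (@pi_uniq (pb2 z <* a)).
- by have := pi_ev_in (z <* a); rewrite gmapJ.
- by rewrite gmapJ; apply: imset_f; exact: pi_ev_in.
- by rewrite gmapJ !pi_ev_over gmapJ.
Qed.
Definition pi_ev : gmap (pb l pi_str) B := GMap pi_evJ.

Lemma pi_ev_uniq z b : b \in (pi_sec (pb2 z) : {set B}) -> p b = pb1 z ->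
  pi_ev z = b.
Proof.
move=> bz e; apply: (pi_uniq (pi_ev_in z) bz).
by rewrite pi_ev_over e.
Qed.

Section Universal.
Variables (U : gset) (u : gmap U D) (w : gmap (pb l u) B).
Hypothesis wC : forall z, p (w z) = pb1 z.

Definition pi_lift_set (x : U) : {set B} :=
  [set b | [exists z : pb l u, (pb2 z == x) && (w z == b)]].

Lemma pi_liftP x : pi_pred (u x, pi_lift_set x).
Proof.
apply/andP; split.
  apply/forall_inP => b; rewrite inE => /existsP[z /andP[/eqP<- /eqP<-]].
  by rewrite /= wC pbE.
apply/forallP => c; apply/implyP => /= /eqP e.
apply/cards1P; exists (w (pb_elt e)); apply/setP => b; rewrite !inE.
apply/andP/eqP => [[/existsP[z /andP[/eqP ez /eqP<-]] /eqP ec]|->].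
  by congr (w _); apply: pb_inj; rewrite ?ez // -wC.
rewrite wC eqxx; split=> //; apply/existsP; exists (pb_elt e).
by rewrite !eqxx.
Qed.

Definition pi_lift_fun (x : U) : pi := exist _ (_, _) (pi_liftP x).
Lemma pi_liftJ x a : pi_lift_fun (x <* a) = pi_lift_fun x <* a.
Proof.
apply/esym/pi_ext; first by rewrite /= gmapJ.
move=> _ /imsetP[b + ->]; rewrite !inE => /existsP[z /andP[/eqP<- /eqP<-]].
by apply/existsP; exists (z <* a); rewrite !gmapJ !eqxx.
Qed.
Definition pi_lift : gmap U pi := GMap pi_liftJ.

(* Pi_l is right adjoint to the pullback functor along l. *)
Lemma pi_universal :
  [/\ forall x, pi_str (pi_lift x) = u x,
      forall (z : pb l u) (z' : pb l pi_str),
        pb1 z' = pb1 z -> pb2 z' = pi_lift (pb2 z) -> pi_ev z' = w z &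
      forall v : gmap U pi, (forall x, pi_str (v x) = u x) ->
        (forall (z : pb l u) (z' : pb l pi_str),
           pb1 z' = pb1 z -> pb2 z' = v (pb2 z) -> pi_ev z' = w z) ->
        v =1 pi_lift].
Proof.
split=> // [z z' e1 e2|v v1 v2 x].
  apply: pi_ev_uniq; last by rewrite wC.
  by rewrite e2 inE; apply/existsP; exists z; rewrite !eqxx.
apply/esym/pi_ext; first by rewrite v1.
move=> b; rewrite !inE => /existsP[z /andP[/eqP ez /eqP<-]].
have e : l (pb1 z) = pi_str (v x) by rewrite v1 -ez pbE.
by rewrite -(v2 z (pb_elt e)) ?ez //; exact: (pi_ev_in (pb_elt e)).
Qed.
End Universal.
End DependentProduct.
Arguments pi_sec {B C D p l}.

Lemma inj_surj_bij (X Y : finType) (f : X -> Y) :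
  injective f -> (forall y, exists x, f x = y) -> bijective f.
Proof.
move=> fI fS; have fS' y : exists x, f x == y.
  by have [x <-] := fS y; exists x.
exists (fun y => xchoose (fS' y)) => [x|y].
  by apply: fI; apply/eqP; exact: (xchooseP (fS' (f x))).
by apply/eqP; exact: (xchooseP (fS' y)).
Qed.

(* Wide, pullback stable, and with finite coproducts created in finite G-sets:
   the last four fields say that the empty set and disjoint unions, with their
   usual structure maps, are also coproducts in the subcategory. *)
Record indexing_category := IndexingCategory {
  ic_mem : forall X Y, gmap X Y -> Prop;
  ic_id : forall X, ic_mem (gid X);
  ic_comp : forall X Y Z (g : gmap Y Z) (f : gmap X Y),
    ic_mem g -> ic_mem f -> ic_mem (gcomp g f);
  ic_pullback : forall A B C D (f : gmap A C) (k : gmap A B) (g : gmap B D)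
      (h : gmap C D),
    is_pullback f k g h -> ic_mem g -> ic_mem f;
  ic_empty : forall X, ic_mem (from_empty X);
  ic_inl : forall X Y, ic_mem (ginl X Y);
  ic_inr : forall X Y, ic_mem (ginr X Y);
  ic_copair : forall X Y Z (f : gmap X Z) (g : gmap Y Z),
    ic_mem f -> ic_mem g -> ic_mem (gcopair f g)
}.

Record span (X Y : gset) :=
  Span { sS : gset; sf : gmap sS X; sh : gmap sS Y }.

Definition span_iso X Y (s t : span X Y) : Prop :=
  exists u : gmap (sS s) (sS t),
    [/\ bijective u, forall x, sf t (u x) = sf s x &
        forall x, sh t (u x) = sh s x].

Definition span_id X : span X X := Span (gid X) (gid X).
(* First s, then t. *)
Definition span_comp X Y Z (s : span X Y) (t : span Y Z) : span X Z :=
  Span (gcomp (sf s) (pb1 (f := sh s) (g := sf t))) (gcomp (sh t) pb2).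
Definition span_add X Y (s t : span X Y) : span X Y :=
  Span (gcopair (sf s) (sf t)) (gcopair (sh s) (sh t)).
Definition span_prod X X' Y Y' (s : span X X') (t : span Y Y') :
    span (prodg X Y) (prodg X' Y') :=
  Span (prod_gmap (sf s) (sf t)) (prod_gmap (sh s) (sh t)).
Definition spanR X Y (f : gmap Y X) : span X Y := Span f (gid Y).
Definition spanT X Y (h : gmap X Y) : span X Y := Span (gid X) h.

Section Polynomials.
Variable O : indexing_category.

Lemma ic_pb1 X Y Z (f : gmap X Z) (g : gmap Y Z) :
  ic_mem O g -> ic_mem O (pb1 (f := f) (g := g)).
Proof. by apply: ic_pullback; exact: pb_is_pullback. Qed.

Lemma pb_is_pullbackC X Y Z (f : gmap X Z) (g : gmap Y Z) :
  is_pullback (pb2 (f := f) (g := g)) pb1 f g.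
Proof.
split=> [z|U u v e]; first by rewrite -pbE.
exists (pb_lift (fun x => esym (e x))); split=> // w' e1 e2 x.
by apply: pb_inj; rewrite ?e1 ?e2.
Qed.

Lemma ic_pb2 X Y Z (f : gmap X Z) (g : gmap Y Z) :
  ic_mem O f -> ic_mem O (pb2 (f := f) (g := g)).
Proof. by apply: ic_pullback; exact: pb_is_pullbackC. Qed.

Arguments ic_pb1 {X Y Z f g} _.
Arguments ic_pb2 {X Y Z f g} _.

(* X <-bf- A -bg-> B -bh-> Y.  Morphisms of polynomials are isomorphism classes
   of these; every construction below is invariant under bispan_iso. *)
Record bispan (X Y : gset) := Bispan {
  bA : gset; bB : gset;
  bf : gmap bA X;
  bg : gmap bA bB;
  bgO : ic_mem O bg;
  bh : gmap bB Y
}.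

Definition bispan_iso X Y (p q : bispan X Y) : Prop :=
  exists (u : gmap (bA p) (bA q)) (v : gmap (bB p) (bB q)),
    [/\ bijective u, bijective v, forall a, bf q (u a) = bf p a,
        forall a, bg q (u a) = v (bg p a) & forall b, bh q (v b) = bh p b].

Definition bspan X Y (s : span X Y) : bispan X Y :=
  Bispan (sf s) (ic_id O (sS s)) (sh s).
Definition bR X Y (f : gmap Y X) : bispan X Y := bspan (spanR f).
Definition bT X Y (h : gmap X Y) : bispan X Y := bspan (spanT h).
Definition bN X Y (g : gmap X Y) (gO : ic_mem O g) : bispan X Y :=
  Bispan (gid X) gO (gid Y).
Definition bid X : bispan X X := bN (ic_id O X).

(* T_m N_l R_k T_h N_g R_f for p = T_h N_g R_f and q = T_m N_l R_k:
     R_k T_h   = T_h' R_k'        with B' = B x_Y C, k' = b1, h' = b2;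
     N_l T_h'  = T_s N_l' R_e     with E = Pi_l B' -> D, E' = C x_D E, e = ev;
     R_k' N_g  = N_g' R_k''       with A' = A x_B B';
     R_e N_g'  = N_g'' R_e'       with A'' = A' x_B' E'. *)
Section Comp.
Variables (X Y Z : gset) (p : bispan X Y) (q : bispan Y Z).
Definition bcB' : gset := pb (bh p) (bf q).
Definition bc_b1 : gmap bcB' (bB p) := pb1.
Definition bc_b2 : gmap bcB' (bA q) := pb2.
Definition bcE : gset := pi bc_b2 (bg q).
Definition bc_s : gmap bcE (bB q) := pi_str bc_b2 (bg q).
Definition bcE' : gset := pb (bg q) bc_s.
Definition bc_ev : gmap bcE' bcB' := pi_ev bc_b2 (bg q).
Definition bcA' : gset := pb (bg p) bc_b1.
Definition bc_a1 : gmap bcA' (bA p) := pb1.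
Definition bc_a2 : gmap bcA' bcB' := pb2.
Definition bcA'' : gset := pb bc_a2 bc_ev.
Definition bc_g : gmap bcA'' bcE :=
  gcomp (pb2 : gmap bcE' bcE) (pb2 : gmap bcA'' bcE').
Lemma bc_gO : ic_mem O bc_g.
Proof. by apply: ic_comp; apply: ic_pb2; [|apply: ic_pb2]; exact: bgO. Qed.
Definition bcomp : bispan X Z :=
  Bispan (gcomp (bf p) (gcomp bc_a1 (pb1 : gmap bcA'' bcA'))) bc_gO
    (gcomp (bh q) bc_s).
End Comp.

Lemma sum_gmapO X X' Y Y' (f : gmap X X') (g : gmap Y Y') :
  ic_mem O f -> ic_mem O g -> ic_mem O (sum_gmap f g).
Proof.
by move=> fO gO; apply: ic_copair; apply: ic_comp => //; [exact: ic_inl|exact: ic_inr].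
Qed.

Definition badd X Y (p q : bispan X Y) : bispan X Y :=
  Bispan (gcopair (bf p) (bf q)) (sum_gmapO (bgO p) (bgO q))
    (gcopair (bh p) (bh q)).

Lemma foldO X : ic_mem O (gfold X).
Proof. by apply: ic_copair; exact: ic_id. Qed.

(* Criterion for r to be a composite: d : B_r -> D and w : C x_D B_r -> B' must
   exhibit B_r as Pi_l B', and (a, z) must exhibit A_r as A x_B (C x_D B_r). *)
Section Recognition.
Variables (X Y Z : gset) (p : bispan X Y) (q : bispan Y Z) (r : bispan X Z).
Variables (d : gmap (bB r) (bB q)) (w : gmap (pb (bg q) d) (bcB' p q)).
Hypothesis wC : forall z, bc_b2 p q (w z) = pb1 z.
Hypothesis wB : bijective (pi_lift wC).
Variables (a : gmap (bA r) (bA p)) (z : gmap (bA r) (pb (bg q) d)).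
Hypothesis az : forall x, bg p (a x) = bc_b1 p q (w (z x)).
Hypothesis azI : forall x y, a x = a y -> z x = z y -> x = y.
Hypothesis azS : forall a0 z0, bg p a0 = bc_b1 p q (w z0) ->
  exists x, a x = a0 /\ z x = z0.
Hypothesis rf : forall x, bf r x = bf p (a x).
Hypothesis rg : forall x, bg r x = pb2 (z x).
Hypothesis rh : forall b, bh r b = bh q (d b).

Lemma bcomp_recognize : bispan_iso r (bcomp p q).
Proof.
have [u1 u2 _] := pi_universal wC.
pose v : gmap (bB r) (bcE p q) := pi_lift wC.
have e1 x : bg q (pb1 (z x)) = bc_s p q (v (pb2 (z x))) by rewrite pbE.
pose E1 : gmap (bA r) (bcE' p q) :=
  pb_lift (f := bg q) (g := bc_s p q) (u := gcomp pb1 z)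
          (v := gcomp v (gcomp pb2 z)) e1.
have ev1 x : bc_ev p q (E1 x) = w (z x) by apply: u2.
pose A1 : gmap (bA r) (bcA' p q) :=
  pb_lift (f := bg p) (g := bc_b1 p q) (u := a) (v := gcomp w z) az.
have e2 x : bc_a2 p q (A1 x) = bc_ev p q (E1 x) by rewrite ev1.
exists (pb_lift e2), v; split=> //.
- apply: inj_surj_bij => [x y e|y].
    have eA : A1 x = A1 y by exact: (congr1 pb1 e).
    have eE : E1 x = E1 y by exact: (congr1 pb2 e).
    apply: azI; first exact: (congr1 pb1 eA).
    apply: pb_inj; first exact: (congr1 pb1 eE).
    have /= := congr1 pb2 eE; exact: (bij_inj wB).
  have [v' _ vK] := wB.
  pose b0 := v' (pb2 (pb2 y)).
  have ez : bg q (pb1 (pb2 y)) = d b0.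
    by rewrite -(u1 b0) /b0 vK pbE.
  pose z0 := pb_elt (f := bg q) (g := d) ez.
  have ew : w z0 = bc_ev p q (pb2 y) by apply/esym/u2 => //; rewrite -[pb2 z0]/(v' _) vK.
  have [x [xa xz]] : exists x, a x = pb1 (pb1 y) /\ z x = z0.
    apply: azS; rewrite ew -(pbE y) -(pbE (pb1 y)).
    by [].
  have E2 : E1 x = pb2 y.
    apply: pb_inj; first exact: (congr1 pb1 xz).
    exact: (etrans (congr1 (fun t => v (pb2 t)) xz) (vK _)).
  exists x; apply: pb_inj; last exact: E2.
  apply: pb_inj; first exact: xa.
  exact: (etrans (congr1 w xz) (etrans ew (esym (pbE y)))).
- by move=> x; rewrite /= rg.
Qed.
End Recognition.

(* Pi along an identity is trivial, so p followed by a span is a pullback. *)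
Lemma bcomp_span X Y Z (p : bispan X Y) (t : span Y Z) :
  bispan_iso
    (Bispan (gcomp (bf p) (pb1 (f := bg p) (g := pb1 (f := bh p) (g := sf t))))
       (ic_pb2 (bgO p)) (gcomp (sh t) (pb2 (f := bh p) (g := sf t))))
    (bcomp p (bspan t)).
Proof.
set r := Bispan _ _ _.
pose d : gmap (bB r) (bB (bspan t)) := pb2.
pose w : gmap (pb (bg (bspan t)) d) (bcB' p (bspan t)) := pb2.
have wC z : bc_b2 p (bspan t) (w z) = pb1 z by rewrite -(pbE z).
have [u1 u2 _] := pi_universal wC.
have ez (x : bA r) : bg (bspan t) (d (bg r x)) = d (bg r x) by [].
apply: (@bcomp_recognize _ _ _ _ _ r d w wC _ pb1
          (pb_lift (u := gcomp d (bg r)) (v := bg r) ez)) => //.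
- apply: inj_surj_bij => [x y e|e].
    pose z0 x0 := pb_elt (erefl : bg (bspan t) (d x0) = d x0).
    rewrite -[x]/(w (z0 x)) -[y]/(w (z0 y)).
    have e1 x0 : bg (bspan t) (d x0) = bc_s p (bspan t) (pi_lift wC x0) by [].
    rewrite -(u2 (z0 x) (pb_elt (e1 x))) //.
    rewrite -(u2 (z0 y) (pb_elt (e1 x))) //.
    by rewrite -[LHS]u1 e u1.
  have e0 : bg (bspan t) (bc_s p (bspan t) e) = bc_s p (bspan t) e by [].
  pose z' : bcE' p (bspan t) := pb_elt e0.
  exists (bc_ev _ _ z'); apply: pi_ext.
    by rewrite u1 /d; exact: (pi_ev_over z').
  move=> b; rewrite inE => /existsP[z /andP[/eqP ez' /eqP <-]].
  by rewrite /w ez'; exact: (pi_ev_in z').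
- by move=> x; exact: (pbE x).
- by move=> x y ea /(congr1 pb2) ez'; apply: pb_inj.
- move=> a0 z0 e; exists (pb_elt (e : bg p a0 = pb1 (pb2 z0))); split=> //.
  apply: pb_inj => //=; exact: wC.
Qed.

(* q after N_g R_f only needs the pullback of g along f_q. *)
Lemma bcomp_NR X A B Z (f : gmap A X) (g : gmap A B) (gO : ic_mem O g)
    (q : bispan B Z) :
  bispan_iso
    (Bispan (gcomp f (pb1 (f := g) (g := bf q)))
       (ic_comp (bgO q) (ic_pb2 gO)) (bh q))
    (bcomp (Bispan f gO (gid B)) q).
Proof.
set r := Bispan _ _ _; set p := Bispan f gO _.
pose d : gmap (bB r) (bB q) := gid _.
have e0 (z : pb (bg q) d) : bh p (bf q (pb1 z)) = bf q (pb1 z) by [].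
pose w : gmap (pb (bg q) d) (bcB' p q) :=
  pb_lift (u := gcomp (bf q) pb1) (v := pb1) e0.
have wC z : bc_b2 p q (w z) = pb1 z by [].
have [u1 u2 _] := pi_universal wC.
have ez (x : bA r) : bg q (pb2 x) = d (bg r x) by [].
apply: (@bcomp_recognize _ _ _ _ _ r d w wC _ pb1
          (pb_lift (u := pb2) (v := bg r) ez)) => //.
- apply: inj_surj_bij => [x y e|e].
    by rewrite -[x]/(d x) -[y]/(d y) -(u1 x) e u1.
  exists (bc_s _ _ e); apply/esym/pi_ext; first by rewrite u1.
  move=> b be; rewrite inE; apply/existsP.
  exists (pb_elt (pi_secP be : bg q _ = d _)); apply/andP; split; first exact/eqP.
  by apply/eqP/pb_inj => //; rewrite /= -[LHS](pbE b).
- by move=> x; exact: (pbE x).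
- by move=> x y ea /(congr1 pb1) ez'; apply: pb_inj.
- move=> a0 z0 e; exists (pb_elt (e : g a0 = bf q (pb1 z0))); split=> //.
  by apply: pb_inj => //; rewrite -[pb2 z0]/(d _) -(pbE z0).
Qed.

Section FoldPullback.
Variables (A Y : gset) (h : gmap A Y).
Definition fold_pb_fun (z : pb (gfold Y) h) : sumg A Y :=
  match pb1 z with inl _ => inl (pb2 z) | inr y => inr y end.
Lemma fold_pbJ z a : fold_pb_fun (z <* a) = fold_pb_fun z <* a.
Proof. by rewrite /fold_pb_fun !gmapJ; case: (pb1 z). Qed.
Definition fold_pb : gmap (pb (gfold Y) h) (sumg A Y) := GMap fold_pbJ.
Lemma fold_pbE z :
  fold_pb z = match pb1 z with inl _ => inl (pb2 z) | inr y => inr y end.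
Proof. by []. Qed.
End FoldPullback.

(* Pi along the fold map Y + Y -> Y of h + id : A + Y -> Y + Y is h : A -> Y. *)
Lemma bcomp_fold A Y (h : gmap A Y) :
  bispan_iso
    (Bispan (sum_gmap (gid A) h) (foldO A) h)
    (bcomp (bT (sum_gmap h (gid Y))) (bN (foldO Y))).
Proof.
set r := Bispan _ _ _; set p := bT _; set q := bN _.
pose d : gmap (bB r) (bB q) := h.
pose W := fold_pb h; have WE := @fold_pbE _ _ h.
have e0 (z : pb (bg q) d) : bh p (W z) = bf q (pb1 z).
  rewrite WE; have := pbE z; case: (pb1 z) => y //= ->.
  by [].
pose w : gmap (pb (bg q) d) (bcB' p q) := pb_lift (u := W) (v := pb1) e0.
have wC z : bc_b2 p q (w z) = pb1 z by [].
have [u1 u2 _] := pi_universal wC.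
have ez (x : bA r) : bg q (sum_gmap h h x) = d (bg r x) by case: x.
apply: (@bcomp_recognize _ _ _ _ _ r d w wC _ (sum_gmap (gid A) h)
          (pb_lift (u := sum_gmap h h) (v := bg r) ez)) => //.
- apply: inj_surj_bij => [x y e|e].
    pose z0 x0 := pb_elt (erefl : bg q (inl (h x0)) = d x0).
    have exy : d x = d y by rewrite -!u1 e.
    have e1 x0 : bg q (inl (h x0)) = bc_s p q (pi_lift wC x0) by [].
    have : W (z0 x) = W (z0 y).
      rewrite -[W (z0 x)]/(pb1 (w (z0 x))) -[W (z0 y)]/(pb1 (w (z0 y))).
      rewrite -(u2 (z0 x) (pb_elt (e1 x))) //.
      rewrite -(u2 (z0 y) (pb_elt (e1 x))) //=; first by congr inl.
    by rewrite !WE /= => -[].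
  have [b /andP[be /eqP eb]] := pi_sec_ex (erefl : bg q (inl (bc_s _ _ e)) = _).
  have := pbE b; rewrite -[pb2 b]/(bc_b2 p q b) eb.
  case eb1 : (pb1 b : (A + Y)%type) => [x|y] //= [ex].
  exists x; apply: (@pi_ext _ _ _ (bc_b2 p q) (bg q) (pi_lift wC x) e).
    by rewrite u1 /d ex.
  move=> b'; rewrite inE => /existsP[z /andP[/eqP zx /eqP <-]].
  have [b2 /andP[b2e /eqP eb2]] : exists b2, (b2 \in (pi_sec e : {set _})) &&
      (bc_b2 p q b2 == pb1 z).
    by apply: pi_sec_ex; rewrite pbE zx.
  suff -> : w z = b2 by [].
  apply: pb_inj; last by rewrite -[pb2 b2]/(bc_b2 p q b2) eb2.
  rewrite -[LHS]/(fold_pb h z) WE; have := pbE b2; rewrite -[pb2 b2]/(bc_b2 p q b2) eb2.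
  case ez1 : (pb1 z : (Y + Y)%type) => [y|y]; last first.
    by case: (pb1 b2 : (A + Y)%type) => //= ? [->].
  rewrite zx => _; suff -> : b2 = b by rewrite eb1.
  apply: (pi_uniq b2e be); rewrite eb eb2 ez1; congr inl.
  by have : gfold Y (pb1 z) = h (pb2 z) := pbE z; rewrite ez1 zx ex.
- by case.
- move=> x y ea /(congr1 pb2); case: x ea => x; case: y => y //=.
  + by move=> _ ->.
  + by move=> _ ->.
- move=> a0 z0 e.
  have {}e : a0 = fold_pb h z0 by exact: e.
  have zE : gfold Y (pb1 z0) = h (pb2 z0) := pbE z0.
  move: e; rewrite WE; case ez1 : (pb1 z0 : (Y + Y)%type) => [y|y] ->.
    exists (inl (pb2 z0)); split=> //; apply: pb_inj => //.
    by rewrite ez1 -[LHS]/(inl (h (pb2 z0))) -zE ez1.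
  have yE : y = h (pb2 z0) by rewrite -zE ez1.
  exists (inr (pb2 z0)); split; first by rewrite yE.
  by apply: pb_inj => //; rewrite ez1 yE.
Qed.

End Polynomials.

Definition is_cart (A B C D : gset) (a : gmap A C) (b : gmap A B)
    (g : gmap B D) (h : gmap C D) : Prop :=
  [/\ forall x, h (a x) = g (b x),
      forall x y, a x = a y -> b x = b y -> x = y &
      forall u v, h u = g v -> exists x, a x = u /\ b x = v].

Lemma gid_bij X : bijective (gid X). Proof. by exists id. Qed.

Section SpanFunctors.
Variables (V : gset -> Type) (phi : forall X Y, span X Y -> V X -> V Y).
Hypothesis phi_iso : forall X Y (s t : span X Y), span_iso s t ->
  phi s =1 phi t.
Hypothesis phi_id : forall X, phi (span_id X) =1 id.
Hypothesis phi_comp : forall X Y Z (s : span X Y) (t : span Y Z) x,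
  phi (span_comp s t) x = phi t (phi s x).

Lemma phi_ext X Y S (f f' : gmap S X) (h h' : gmap S Y) : f =1 f' -> h =1 h' ->
  phi (Span f h) =1 phi (Span f' h').
Proof.
move=> ef eh; apply: phi_iso; exists (gid S); split=> //; exact: gid_bij.
Qed.

Lemma phi_cart X Y Z (s : span X Y) (t : span Y Z) S
    (a : gmap S (sS s)) (b : gmap S (sS t)) x :
  is_cart a b (sf t) (sh s) ->
  phi t (phi s x) = phi (Span (gcomp (sf s) a) (gcomp (sh t) b)) x.
Proof.
case=> e aI aS; rewrite -phi_comp; apply/esym/phi_iso.
exists (pb_lift e); split=> //; apply: inj_surj_bij => [u v euv|z].
  apply: aI; [exact: (congr1 pb1 euv)|exact: (congr1 pb2 euv)].
have [u [eu ev]] := aS _ _ (pbE z).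
by exists u; apply: pb_inj.
Qed.

Lemma phi_RR X Y Z (f : gmap Y X) (g : gmap Z Y) x :
  phi (spanR g) (phi (spanR f) x) = phi (spanR (gcomp f g)) x.
Proof.
rewrite (@phi_cart _ _ _ (spanR f) (spanR g) Z g (gid Z)); first exact: phi_ext.
by split=> // u v e; exists v.
Qed.

Lemma phi_TT X Y Z (f : gmap X Y) (g : gmap Y Z) x :
  phi (spanT g) (phi (spanT f) x) = phi (spanT (gcomp g f)) x.
Proof.
rewrite (@phi_cart _ _ _ (spanT f) (spanT g) X (gid X) f); first exact: phi_ext.
by split=> // u v e; exists u.
Qed.

Lemma phi_TR X Y S (f : gmap S X) (h : gmap S Y) x :
  phi (Span f h) x = phi (spanT h) (phi (spanR f) x).
Proof.
rewrite (@phi_cart _ _ _ (spanR f) (spanT h) S (gid S) (gid S));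
  first exact: phi_ext.
by split=> // u v e; exists u.
Qed.

Lemma phi_RT A B C D (a : gmap A C) (b : gmap A B) (g : gmap B D)
    (h : gmap C D) x :
  is_cart a b g h ->
  phi (spanR g) (phi (spanT h) x) = phi (spanT b) (phi (spanR a) x).
Proof.
move=> c; rewrite (@phi_cart _ _ _ (spanT h) (spanR g) _ _ _ _ c) -phi_TR.
exact: phi_ext.
Qed.

Lemma phi_R1 X (f : gmap X X) x : f =1 id -> phi (spanR f) x = x.
Proof. by move=> e; rewrite -[RHS](phi_id x); exact: phi_ext. Qed.

Lemma phi_Tinv X Y (h : gmap X Y) (k : gmap Y X) x :
  cancel h k -> cancel k h -> phi (spanT h) x = phi (spanR k) x.
Proof.
move=> hK kK; apply: phi_iso; exists h; split=> //; by exists k.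
Qed.
End SpanFunctors.

(* A^G(X, Y) is the group completion of the monoid of isomorphism classes of
   spans, so an additive functor on the Burnside category amounts to additive
   maps indexed by spans, compatible with isomorphism, composition and
   disjoint union of spans. *)
Record mackey := Mackey {
  mval :> gset -> zmodType;
  mmap : forall X Y, span X Y -> mval X -> mval Y;
  mmapD : forall X Y (s : span X Y), {morph mmap s : x y / x + y};
  mmap_iso : forall X Y (s t : span X Y), span_iso s t -> mmap s =1 mmap t;
  mmap_id : forall X, mmap (span_id X) =1 id;
  mmap_comp : forall X Y Z (s : span X Y) (t : span Y Z) x,
    mmap (span_comp s t) x = mmap t (mmap s x);
  mmap_add : forall X Y (s t : span X Y) x,
    mmap (span_add s t) x = mmap s x + mmap t x
}.

Record mackey_map (M N : mackey) := MackeyMap {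
  mm : forall X, M X -> N X;
  mmD : forall X, {morph @mm X : x y / x + y};
  mm_nat : forall X Y (s : span X Y) x, mm (mmap s x) = mmap s (mm x)
}.

(* A natural transformation M(X) (x) N(Y) -> P(X x Y). *)
Record is_pairing (M N P : mackey)
    (th : forall X Y, M X -> N Y -> P (prodg X Y)) : Prop := IsPairing {
  pairingDl : forall X Y (b : N Y), {morph (fun a : M X => th X Y a b) : a a' / a + a'};
  pairingDr : forall X Y (a : M X), {morph th X Y a : b b' / b + b'};
  pairing_nat : forall X X' Y Y' (s : span X X') (t : span Y Y') a b,
    th _ _ (mmap s a) (mmap t b) = mmap (span_prod s t) (th _ _ a b)
}.

(* Day convolution: P = M [] N is the left Kan extension of
   (X, Y) |-> M(X) (x) N(Y) along the product of finite G-sets. *)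
Definition is_box (M N P : mackey)
    (th : forall X Y, M X -> N Y -> P (prodg X Y)) : Prop :=
  is_pairing th /\
  forall (Q : mackey) (ps : forall X Y, M X -> N Y -> Q (prodg X Y)),
    is_pairing ps ->
    exists f : mackey_map P Q,
      (forall X Y a b, mm f (th X Y a b) = ps X Y a b) /\
      forall f' : mackey_map P Q,
        (forall X Y a b, mm f' (th X Y a b) = ps X Y a b) ->
        forall X (x : P X), mm f' x = mm f x.

Definition gassoc (X Y Z : gset) :
    gmap (prodg (prodg X Y) Z) (prodg X (prodg Y Z)) :=
  gpair (gcomp (gfst X Y) (gfst _ Z))
    (gpair (gcomp (gsnd X Y) (gfst _ Z)) (gsnd _ Z)).
Definition gswap (X Y : gset) : gmap (prodg X Y) (prodg Y X) :=
  gpair (gsnd X Y) (gfst X Y).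

(* A commutative monoid for the box product; maps out of R [] R and out of
   the unit are given by pairings and by elements of R(G/G). *)
Record green := Green {
  gmack :> mackey;
  gmul : forall X Y, gmack X -> gmack Y -> gmack (prodg X Y);
  gone : gmack pointg;
  gmul_pairing : is_pairing gmul;
  gmulA : forall X Y Z (a : gmack X) (b : gmack Y) (c : gmack Z),
    mmap (spanT (gassoc X Y Z)) (gmul (gmul a b) c) = gmul a (gmul b c);
  gmulC : forall X Y (a : gmack X) (b : gmack Y),
    mmap (spanT (gswap X Y)) (gmul a b) = gmul b a;
  gmul1 : forall X (a : gmack X),
    mmap (spanT (gsnd pointg X)) (gmul gone a) = a
}.

Record gmodule (R : green) := GModule {
  modm :> mackey;
  mact : forall X Y, R X -> modm Y -> modm (prodg X Y);
  mact_pairing : is_pairing mact;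
  mactA : forall X Y Z (a : R X) (b : R Y) (m : modm Z),
    mmap (spanT (gassoc X Y Z)) (mact (gmul a b) m) = mact a (mact b m);
  mact1 : forall X (m : modm X),
    mmap (spanT (gsnd pointg X)) (mact (gone R) m) = m
}.

Definition is_module_map (R : green) (M N : gmodule R) (f : mackey_map M N) :
    Prop :=
  forall X Y (a : R X) (m : M Y), mm f (mact a m) = mact a (mm f m).

(* u exhibits V as the group completion of the commutative monoid of elements
   of M modulo eqM. *)
Definition is_group_completion (M : Type) (eqM : M -> M -> Prop)
    (addM : M -> M -> M) (V : zmodType) (u : M -> V) : Prop :=
  [/\ forall a b, eqM a b -> u a = u b,
      forall a b, u (addM a b) = u a + u b &
      forall (W : zmodType) (v : M -> W),
        (forall a b, eqM a b -> v a = v b) ->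
        (forall a b, v (addM a b) = v a + v b) ->
        exists f : V -> W,
          [/\ {morph f : x y / x + y}, forall a, f (u a) = v a &
              forall f' : V -> W, {morph f' : x y / x + y} ->
                (forall a, f' (u a) = v a) -> f' =1 f]].

(* Q = A^G(T, -), with io sending a span to its class. *)
Definition is_representable (T : gset) (Q : mackey)
    (io : forall X, span T X -> Q X) : Prop :=
  (forall X, is_group_completion (@span_iso T X) (@span_add T X) (@io X)) /\
  forall X Y (s : span T X) (t : span X Y),
    io Y (span_comp s t) = mmap t (io X s).

(* N = R{x_T} = R [] A^G(T, -), where R acts through its multiplication on the
   left factor. *)
Definition is_free_on (R : green) (T : gset) (N : gmodule R) : Prop :=
  exists (Q : mackey) (io : forall X, span T X -> Q X)
      (th : forall X Y, R X -> Q Y -> N (prodg X Y)),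
    [/\ is_representable io, is_box th &
        forall X Y Z (a : R X) (b : R Y) (q : Q Z),
          mact a (th Y Z b q) =
          mmap (spanT (gassoc X Y Z)) (th _ Z (gmul a b) q)].

(* The maps from N i exhibit M as their direct sum, formed levelwise. *)
Definition is_direct_sum (I : Type) (N : I -> mackey) (M : mackey)
    (io : forall i, mackey_map (N i) M) : Prop :=
  forall X (W : zmodType) (v : forall i, N i X -> W),
    (forall i, {morph v i : x y / x + y}) ->
    exists f : M X -> W,
      [/\ {morph f : x y / x + y}, forall i x, f (mm (io i) x) = v i x &
          forall f' : M X -> W, {morph f' : x y / x + y} ->
            (forall i x, f' (mm (io i) x) = v i x) -> f' =1 f].

Definition is_free_module (R : green) (M : gmodule R) : Prop :=
  exists (I : Type) (T : I -> gset) (N : I -> gmodule R)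
      (io : forall i, mackey_map (N i) M),
    [/\ forall i, is_free_on (T i) (N i),
        forall i, is_module_map (io i) & is_direct_sum io].

Section Tambara.
Variable O : indexing_category.

(* A product-preserving functor from polynomials to sets (the product of X and Y
   being their disjoint union, with projections the two restrictions) whose
   values are abelian groups; tmap_add and tmap_mul
   say that the ring structure on each value is the one induced by the functor
   (a pair of elements of R(X) being an element of R(X + X)). *)
Record tambara := Tambara {
  tval :> gset -> comPzRingType;
  tmap : forall X Y, bispan O X Y -> tval X -> tval Y;
  tmap_iso : forall X Y (p q : bispan O X Y), bispan_iso p q ->
    tmap p =1 tmap q;
  tmap_id : forall X, tmap (bid O X) =1 id;
  tmap_comp : forall X Y Z (p : bispan O X Y) (q : bispan O Y Z) x,
    tmap (bcomp p q) x = tmap q (tmap p x);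
  tmap_prod : forall X Y, bijective (fun c : tval (sumg X Y) =>
    (tmap (bR O (ginl X Y)) c, tmap (bR O (ginr X Y)) c));
  tmap_empty : forall a b : tval emptyg, a = b;
  tmap_add : forall X (c : tval (sumg X X)),
    tmap (bT O (gfold X)) c =
    tmap (bR O (ginl X X)) c + tmap (bR O (ginr X X)) c;
  tmap_mul : forall X (c : tval (sumg X X)),
    tmap (bN (foldO O X)) c =
    tmap (bR O (ginl X X)) c * tmap (bR O (ginr X X)) c
}.

Record tambara_map (R R' : tambara) := TambaraMap {
  tm : forall X, R X -> R' X;
  tm_nat : forall X Y (p : bispan O X Y) x, tm (tmap p x) = tmap p (tm x)
}.

Section Underlying.
Variable R : tambara.

Definition ts X Y (s : span X Y) : R X -> R Y := tmap (bspan O s).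
Local Notation tR f := (ts (spanR f)).
Local Notation tT h := (ts (spanT h)).
Local Notation tN gO := (tmap (t := R) (bN gO)).

Lemma ts_iso X Y (s t : span X Y) : span_iso s t -> ts s =1 ts t.
Proof.
case=> u [uB uf uh]; apply: tmap_iso; exists u, u; split=> //.
Qed.

Lemma ts_id X : ts (span_id X) =1 id.
Proof. by move=> x; exact: tmap_id. Qed.

Lemma tmap_span X Y Z (p : bispan O X Y) (t : span Y Z) (r : bispan O X Z)
    (a : gmap (bA r) (bA p)) (b : gmap (bB r) (bB p)) (c : gmap (bB r) (sS t)) x :
  is_cart b c (sf t) (bh p) -> is_cart a (bg r) b (bg p) ->
  (forall x, bf r x = bf p (a x)) -> (forall x, bh r x = sh t (c x)) ->
  ts t (tmap p x) = tmap r x.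
Proof.
move=> [e1 I1 S1] [e2 I2 S2] ef eh.
rewrite /ts -tmap_comp -(tmap_iso (bcomp_span p t)); apply/esym/tmap_iso.
have vB : bijective (pb_lift e1).
  apply: inj_surj_bij => [u v e|z].
    by apply: I1; [exact: (congr1 pb1 e)|exact: (congr1 pb2 e)].
  have [u [eu ev]] := S1 _ _ (pbE z).
  by exists u; apply: pb_inj.
exists (pb_lift (f := bg p) (g := pb1 (f := bh p) (g := sf t))
  (u := a) (v := gcomp (pb_lift e1) (bg r)) e2), (pb_lift e1); split=> //.
- apply: inj_surj_bij => [u v e|z].
    apply: I2; first exact: (congr1 pb1 e).
    exact: (bij_inj vB (congr1 pb2 e)).
  have [v _ vK] := vB; pose b0 := v (pb2 z).
  have eb : pb_lift e1 b0 = pb2 z by exact: vK.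
  have eb0 : b b0 = pb1 (pb2 z) by rewrite -eb.
  have [u [eu ev]] : exists u, a u = pb1 z /\ bg r u = b0.
    by apply: S2; rewrite eb0 -(pbE z).
  by exists u; apply: pb_inj => //; rewrite -eb -ev.
Qed.

Lemma ts_comp X Y Z (s : span X Y) (t : span Y Z) x :
  ts (span_comp s t) x = ts t (ts s x).
Proof.
apply/esym; apply: (@tmap_span _ _ _ (bspan O s) t (bspan O (span_comp s t))
  pb1 pb1 pb2) => //.
- split; [exact: pbE|exact: pb_inj|].
  by move=> u v e; exists (pb_elt e).
- by split=> // u v e; exists v.
Qed.

Let RR := phi_RR ts_iso ts_comp.
Let TT := phi_TT ts_iso ts_comp.
Let TR := phi_TR ts_iso ts_comp.
Let RT := phi_RT ts_iso ts_comp.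
Let sE := phi_ext ts_iso.

Lemma tpair X Y (a : R X) (b : R Y) :
  exists c : R (sumg X Y), tR (ginl X Y) c = a /\ tR (ginr X Y) c = b.
Proof. by have [g _ /(_ (a, b)) []] := tmap_prod R X Y; exists (g (a, b)). Qed.

Lemma tpair_inj X Y (c c' : R (sumg X Y)) :
  tR (ginl X Y) c = tR (ginl X Y) c' -> tR (ginr X Y) c = tR (ginr X Y) c' ->
  c = c'.
Proof.
by move=> e1 e2; apply: (bij_inj (tmap_prod R X Y)); congr pair.
Qed.

Lemma tR_add X Y (f : gmap Y X) : {morph tR f : a b / a + b}.
Proof.
move=> a b; have [c [ea eb]] := tpair a b.
rewrite -{1}ea -{1}eb -(tmap_add c) -/(tT _ _).
rewrite (RT (a := sum_gmap f f) (b := gfold Y)).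
  rewrite [LHS]tmap_add -!/(tR _ _) !RR -ea -eb !RR.
  by congr (_ + _); apply: sE.
split=> [[]//|[]x []y //=|u v].
  by move=> _ ->.
  by move=> _ ->.
case: u => u /= e; [exists (inl v)|exists (inr v)]; by rewrite /= -e.
Qed.

Lemma sum_fold_cartl X Y X' Y' (h : gmap X Y) (h' : gmap X' Y') :
  is_cart (ginl X X') h (ginl Y Y') (sum_gmap h h').
Proof.
split=> // [x y [] //|[u|u] v //= [<-]]; by exists u.
Qed.
Lemma sum_fold_cartr X Y X' Y' (h : gmap X Y) (h' : gmap X' Y') :
  is_cart (ginr X X') h' (ginr Y Y') (sum_gmap h h').
Proof.
split=> // [x y [] //|[u|u] v //= [<-]]; by exists u.
Qed.

Lemma tT_add X Y (h : gmap X Y) : {morph tT h : a b / a + b}.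
Proof.
move=> a b; have [c [ea eb]] := tpair a b.
rewrite -{1}ea -{1}eb -(tmap_add c) -/(tT _ _) TT.
rewrite (sE (f' := gid _) (h' := gcomp (gfold Y) (sum_gmap h h))) //; last by case.
rewrite -TT [LHS]tmap_add -!/(tR _ _).
by rewrite (RT _ (sum_fold_cartl h h)) (RT _ (sum_fold_cartr h h)) ea eb.
Qed.

Lemma ts_add X Y (s : span X Y) : {morph ts s : a b / a + b}.
Proof.
by case: s => S f h a b; rewrite !(TR f h) tR_add tT_add.
Qed.

Lemma ts_span_add X Y (s t : span X Y) x : ts (span_add s t) x = ts s x + ts t x.
Proof.
pose c := ts (Span (gcopair (sf s) (sf t)) (sum_gmap (sh s) (sh t))) x.
have -> : ts (span_add s t) x = tT (gfold Y) c.
  by rewrite /c TR TT /span_add TR; apply: sE => // -[].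
rewrite [LHS]tmap_add -!/(tR _ _) /c TR.
rewrite (RT _ (sum_fold_cartl _ _)) (RT _ (sum_fold_cartr _ _)) !RR -!TR.
by congr (_ + _); apply: ts_iso; exists (gid _); split=> //; exact: gid_bij.
Qed.

Definition mackey_of : mackey :=
  @Mackey (fun X => R X : zmodType) ts ts_add ts_iso ts_id ts_comp ts_span_add.

Lemma tR_N A B C D (a : gmap A C) (b : gmap A B) (g : gmap B D) (h : gmap C D)
    (hO : ic_mem O h) (bO : ic_mem O b) x :
  is_cart a b g h -> tR g (tN hO x) = tN bO (tR a x).
Proof.
move=> c.
rewrite (@tmap_span _ _ _ (bN hO) (spanR g) (Bispan a bO (gid B)) a g (gid B)) //.
  rewrite /ts -tmap_comp -(tmap_iso (bcomp_NR a (ic_id O A) (bN bO))).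
  have e y : gid A y = bf (bN bO) (gid A y) by [].
  apply: tmap_iso; exists (pb_lift (f := gid A) (g := bf (bN bO)) (u := gid A) (v := gid A) e),
    (gid B); split=> //; last exact: gid_bij.
  exists pb1 => // y; apply: pb_inj => //; exact: (pbE y).
by split=> // u v e; exists v.
Qed.

Lemma tN_fold_inr X (x : R X) :
  tN (foldO O X) (tN (ic_inr O X X) x) = x.
Proof.
rewrite -tmap_comp -[RHS](tmap_id x).
rewrite -(tmap_iso (bcomp_NR (gid X) (ic_inr O X X) (bN (foldO O X)))).
have e y : ginr X X y = bf (bN (foldO O X)) (ginr X X y) by [].
apply/esym/tmap_iso.
exists (pb_lift (f := ginr X X) (g := bf (bN (foldO O X))) (u := gid X)
  (v := ginr X X) e), (gid X); split=> //; last exact: gid_bij.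
exists pb1 => // y; apply: pb_inj => //; exact: (pbE y).
Qed.

Lemma tR_mul X Y (f : gmap Y X) : {morph tR f : a b / a * b}.
Proof.
move=> a b; have [c [ea eb]] := tpair a b.
rewrite -{1}ea -{1}eb -(tmap_mul c).
rewrite (@tR_N _ _ _ _ (sum_gmap f f) (gfold Y) f (gfold X) _ (foldO O Y)).
  rewrite [LHS]tmap_mul -!/(tR _ _) !RR -ea -eb !RR.
  by congr (_ * _); apply: sE.
split=> [[]//|[]x []y //=|u v].
  by move=> _ ->.
  by move=> _ ->.
case: u => u /= e; [exists (inl v)|exists (inr v)]; by rewrite /= -e.
Qed.

Lemma tone X : tN (ic_empty O X) 0 = 1.
Proof.
suff h (a : R X) : tN (ic_empty O X) 0 * a = a by rewrite -[LHS]mulr1 h.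
pose c := tN (ic_inr O X X) a.
rewrite -[RHS](tN_fold_inr a) [RHS](tmap_mul c) -!/(tR _ _); congr (_ * _).
  rewrite (@tR_N _ _ _ _ (from_empty X) (from_empty X) _ _ _ (ic_empty O X)).
    by congr (tmap _ _); exact: tmap_empty.
  by split=> // -[].
rewrite (@tR_N _ _ _ _ (gid X) (gid X) _ _ _ (ic_id O X)).
  by rewrite (phi_R1 ts_iso ts_id) // [RHS]tmap_id.
by split=> // u v [->]; exists v.
Qed.

Lemma tR_one X Y (f : gmap Y X) : tR f 1 = 1.
Proof.
rewrite -!tone.
rewrite (@tR_N _ _ _ _ (gid emptyg) (from_empty Y) _ _ _ (ic_empty O Y)).
  by congr (tmap _ _); exact: tmap_empty.
by split=> // -[].
Qed.

Lemma frobenius X Y (h : gmap X Y) a b : tT h a * b = tT h (a * tR h b).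
Proof.
have [c [ea eb]] := tpair a b.
have -> : tT h a * b = tN (foldO O Y) (tT (sum_gmap h (gid Y)) c).
  rewrite tmap_mul -!/(tR _ _).
  rewrite (RT _ (sum_fold_cartl h (gid Y))) (RT _ (sum_fold_cartr h (gid Y))).
  by rewrite ea eb; congr (_ * _); rewrite [RHS]ts_id.
rewrite /ts -tmap_comp -(tmap_iso (bcomp_fold O h)) -!/(ts _ _).
have -> : a * tR h b = tN (foldO O X) (tR (sum_gmap (gid X) h) c).
  rewrite tmap_mul -!/(tR _ _) !RR -{1}ea -{1}eb !RR.
  by congr (_ * _); apply: sE.
have -> : tN (foldO O X) (tR (sum_gmap (gid X) h) c) =
    tmap (Bispan (sum_gmap (gid X) h) (foldO O X) (gid X)) c.
  rewrite {1}/ts -tmap_comp.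
  rewrite -(tmap_iso (bcomp_NR (sum_gmap (gid X) h) (ic_id O _) (bN (foldO O X)))).
  have e y : gid _ y = bf (bN (foldO O X)) (gid _ y) by [].
  apply/esym/tmap_iso.
  exists (pb_lift (f := gid _) (g := bf (bN (foldO O X))) (u := gid _) (v := gid _) e),
    (gid X); split=> //; last exact: gid_bij.
  exists pb1 => // y; apply: pb_inj => //; exact: (pbE y).
rewrite (@tmap_span _ _ _ (Bispan (sum_gmap (gid X) h) (foldO O X) (gid X))
  (spanT h) (Bispan (sum_gmap (gid X) h) (foldO O X) h)
  (gid (sumg X X)) (gid X) (gid X)) //.
  by split=> // u v e; exists u.
by split=> // u v e; exists u.
Qed.

Definition ext_mul X Y (a : R X) (b : R Y) : R (prodg X Y) :=
  tR (gfst X Y) a * tR (gsnd X Y) b.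

Lemma ext_mulTl X X' Y (h : gmap X X') (a : R X) (b : R Y) :
  ext_mul (tT h a) b = tT (prod_gmap h (gid Y)) (ext_mul a b).
Proof.
rewrite /ext_mul (RT _ (a := gfst X Y) (b := prod_gmap h (gid Y))).
  rewrite frobenius RR; congr (ts _ (_ * _)); exact: sE.
split=> // [[x y] [x' y'] /= -> [->]//|u [x y] /= e].
by exists (u, y); rewrite /= e.
Qed.

Lemma ext_mulTr X Y Y' (h : gmap Y Y') (a : R X) (b : R Y) :
  ext_mul a (tT h b) = tT (prod_gmap (gid X) h) (ext_mul a b).
Proof.
rewrite /ext_mul (RT _ (a := gsnd X Y) (b := prod_gmap (gid X) h)).
  rewrite mulrC frobenius RR [X in _ = ts _ X]mulrC.
  by congr (ts _ (_ * _)); exact: sE.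
split=> // [[x y] [x' y'] /= -> [->]//|u [x y] /= e].
by exists (x, u); rewrite /= e.
Qed.

Lemma ext_mulR X X' Y Y' (f : gmap X' X) (g : gmap Y' Y) (a : R X) (b : R Y) :
  ext_mul (tR f a) (tR g b) = tR (prod_gmap f g) (ext_mul a b).
Proof.
by rewrite /ext_mul tR_mul !RR; congr (_ * _); exact: sE.
Qed.

Lemma ext_mul_pairing : is_pairing (M := mackey_of) (N := mackey_of)
  (P := mackey_of) ext_mul.
Proof.
split=> [X Y b a a'|X Y a b b'|X X' Y Y' [S f h] [S' f' h'] a b] /=.
- by rewrite /ext_mul tR_add mulrDl.
- by rewrite /ext_mul tR_add mulrDr.
rewrite (TR f h) (TR f' h') ext_mulTl ext_mulTr TT ext_mulR.
rewrite -TR; exact: sE.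
Qed.

Definition gassocV (X Y Z : gset) :
    gmap (prodg X (prodg Y Z)) (prodg (prodg X Y) Z) :=
  gpair (gpair (gfst _ _) (gcomp (gfst _ _) (gsnd _ _)))
    (gcomp (gsnd _ _) (gsnd _ _)).

Lemma ext_mulA X Y Z (a : R X) (b : R Y) (c : R Z) :
  tT (gassoc X Y Z) (ext_mul (ext_mul a b) c) = ext_mul a (ext_mul b c).
Proof.
rewrite (phi_Tinv ts_iso (k := gassocV X Y Z)); [|by do 2!case|by case=> ? []].
rewrite /ext_mul !tR_mul !RR -mulrA; congr (_ * (_ * _)); exact: sE.
Qed.

Lemma ext_mulC X Y (a : R X) (b : R Y) :
  tT (gswap X Y) (ext_mul a b) = ext_mul b a.
Proof.
rewrite (phi_Tinv ts_iso (k := gswap Y X)); [|by case|by case].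
rewrite /ext_mul !tR_mul !RR mulrC; congr (_ * _); exact: sE.
Qed.

Lemma ext_mul1 X (a : R X) :
  tT (gsnd pointg X) (ext_mul (1 : R pointg) a) = a.
Proof.
rewrite (phi_Tinv ts_iso (k := gpair (to_point X) (gid X)));
  [|by case=> -[]|by []].
by rewrite /ext_mul tR_mul !RR tR_one mul1r (phi_R1 ts_iso ts_id).
Qed.

Definition green_of : green :=
  Green ext_mul_pairing ext_mulA ext_mulC ext_mul1.

End Underlying.

Section Algebra.
Variables (R B : tambara) (i : tambara_map R B).

Lemma tm_mul X : {morph @tm _ _ i X : a b / a * b}.
Proof.
move=> a b; have [c [<- <-]] := tpair a b.
by rewrite -(tmap_mul c) tm_nat tmap_mul /ts -!tm_nat.
Qed.

Lemma tm_add X : {morph @tm _ _ i X : a b / a + b}.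
Proof.
move=> a b; have [c [<- <-]] := tpair a b.
by rewrite -(tmap_add c) tm_nat tmap_add /ts -!tm_nat.
Qed.

Lemma tm_one X : tm i (1 : R X) = 1.
Proof.
rewrite -!tone tm_nat; congr (tmap _ _); exact: tmap_empty.
Qed.

Definition alg_act X Y (a : R X) (b : B Y) : B (prodg X Y) :=
  ext_mul (tm i a) b.

Lemma alg_act_pairing : is_pairing (M := green_of R) (N := mackey_of B)
  (P := mackey_of B) alg_act.
Proof.
have [hl hr hn] := ext_mul_pairing B.
split=> [X Y b a a'|X Y a b b'|X X' Y Y' s t a b] /=.
- by rewrite /alg_act tm_add; exact: hl.
- exact: hr.
- by rewrite /alg_act [tm i _]tm_nat; exact: hn.
Qed.

Lemma alg_actA X Y Z (a : R X) (b : R Y) (c : B Z) :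
  ts (spanT (gassoc X Y Z)) (alg_act (ext_mul a b) c) = alg_act a (alg_act b c).
Proof.
rewrite /alg_act -ext_mulA; congr (ts _ (ext_mul _ _)).
by rewrite /ext_mul tm_mul /ts !tm_nat.
Qed.

Lemma alg_act1 X (b : B X) :
  ts (spanT (gsnd pointg X)) (alg_act (1 : R pointg) b) = b.
Proof. by rewrite /alg_act tm_one ext_mul1. Qed.

(* B as a module over the underlying Green functor of R. *)
Definition module_of : gmodule (green_of R) :=
  @GModule (green_of R) (mackey_of B) alg_act alg_act_pairing alg_actA alg_act1.
End Algebra.

(* B = S [] F, with coprojections i and j. *)
Definition is_tambara_box (S F B : tambara)
    (i : tambara_map S B) (j : tambara_map F B) : Prop :=
  is_box (M := mackey_of S) (N := mackey_of F) (P := mackey_of B)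
    (fun X Y a b => ext_mul (tm i a) (tm j b)).

(* F = P_O(T, -)^+, with io sending a polynomial to its class. *)
Definition is_free_tambara (T : gset) (F : tambara)
    (io : forall X, bispan O T X -> F X) : Prop :=
  (forall X, is_group_completion (@bispan_iso O T X) (@badd O T X) (@io X)) /\
  forall X Y (p : bispan O T X) (q : bispan O X Y),
    io Y (bcomp p q) = tmap q (io X p).

Record gset_over (X : gset) := GOver { gov : gset; gov_map : gmap gov X }.
Definition gover_iso X (u v : gset_over X) : Prop :=
  exists h : gmap (gov u) (gov v),
    bijective h /\ forall x, gov_map v (h x) = gov_map u x.
Definition gover_add X (u v : gset_over X) : gset_over X :=
  GOver (gcopair (gov_map u) (gov_map v)).
(* T_h N_g R_f: pull back along f, apply Pi_g, compose with h. *)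
Definition gover_map X Y (p : bispan O X Y) (u : gset_over X) : gset_over Y :=
  GOver (gcomp (bh p) (pi_str (pb2 (f := gov_map u) (g := bf p)) (bg p))).

(* A is the Burnside Tambara functor, with io sending a finite G-set over X to
   its class. *)
Definition is_burnside (A : tambara)
    (io : forall X, gset_over X -> A X) : Prop :=
  (forall X, is_group_completion (@gover_iso X) (@gover_add X) (@io X)) /\
  forall X Y (p : bispan O X Y) (u : gset_over X),
    io Y (gover_map p u) = tmap p (io X u).

(* G/e as a set over the one-point G-set G/G. *)
Definition free_orbit : gset_over pointg := GOver (to_point (orbitg 1%G)).

Definition is_invertible (V : comPzRingType) (x : V) : Prop :=
  exists y : V, x * y = 1.

(* l is initial among the maps of O-Tambara functors out of A that send s to a
   unit. *)
Definition is_localization (A S : tambara) (s : A pointg)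
    (l : tambara_map A S) : Prop :=
  is_invertible (tm l s) /\
  forall (R : tambara) (k : tambara_map A R), is_invertible (tm k s) ->
    exists f : tambara_map S R,
      (forall X (x : A X), tm f (tm l x) = tm k x) /\
      forall f' : tambara_map S R,
        (forall X (x : A X), tm f' (tm l x) = tm k x) ->
        forall X (x : S X), tm f' x = tm f x.

End Tambara.

End FiniteGSets.

(* Main.v *)
From HB Require Import structures.
From mathcomp Require Import all_boot all_fingroup all_algebra.
From mathcomp Require Import boolp.
Require Import Defs.

(** Write T for the G-set G/H of the generator, E for G/e and F for the free
    Tambara functor on a generator at T, and let B be the box product of S
    and F.

    A polynomial [T <- A -> X = X] attaches to each point of X the monomial, in
    variables indexed by T, given by the fibre of A with its map to T.  Over a
    free G-set this family of monomials determines the polynomial up to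
    isomorphism (expo_iso), and every family of monomials occurs, because a map
    between free G-sets lies in every indexing category
    (ic_stabilizer_preserving).  So at the level G/e the functor F is the
    polynomial ring Z[T], and its underlying group is free on the G-set of
    monomials, the disjoint union of the finite G-sets mon d of monomials of
    degree d.  Over a base with stabilizers this fails, since O may not contain
    the polynomial carrying a given monomial.

    Inverting [E] removes the obstruction: for an S-module M the composite of
    restriction and transfer along E x X -> X is multiplication by [E], so M(X)
    is a retract of M(E x X) (transfer_restrict) and only free G-sets matter.
    In particular the tautological family of monomials over E x mon d descends
    to an element of B(mon d), namely [E]^-1 times its transfer (mon_elt), whose
    restriction along any classifying map K -> mon d is the polynomial that the
    map classifies (mon_elt_restrict).

    The element of B(mon d) is a map of S-modules from the free module on a
    generator at mon d to B (eval_fun), and together these maps are an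
    isomorphism from the direct sum over d.  The inverse sends a polynomial
    T <- A -> X' -> X to the spans mon d <- X'_d -> X, where X'_d is the part
    of X' carrying monomials of degree d (stratum, coef).  One composite is the
    identity by a computation on generators (coef_mon_elt), the other because a
    polynomial is the sum of its pieces over the X'_d (tmap_strata).

    Free modules have a concrete model throughout: spans T <- Z -> X are finite
    G-sets over T x X, so A(T x -) represents T and, by Yoneda, S(T x -) is the
    free S-module on a generator at T (shift_module_free). *)

Set Implicit Arguments.
Unset Strict Implicit.
Unset Printing Implicit Defensive.

Import GRing.Theory.
Local Open Scope ring_scope.

Local Notation "x <* a" := (gop x a).
Local Notation tR f := (ts (spanR f)).
Local Notation tT h := (ts (spanT h)).

Arguments pb1 {G X Y Z f g}.
Arguments pb2 {G X Y Z f g}.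
Arguments pb_inj {G X Y Z f g} z w.

(** * Finite G-sets *)

Section FiniteGSetTools.
Variable G : finGroupType.
Implicit Types X Y Z T : gset G.

Lemma gopV_inv X (P : pred X) :
  (forall x a, P x -> P (x <* a)) -> forall x a, P (x <* a) = P x.
Proof.
move=> PJ x a; apply/idP/idP; last exact: PJ.
by move=> h; rewrite -(gopK x a); exact: PJ.
Qed.

Lemma bij_gmap_inv X Y (f : gmap X Y) : bijective f ->
  exists g : gmap Y X, cancel f g /\ cancel g f.
Proof.
case=> g fK gK; suff gJ y a : g (y <* a) = g y <* a by exists (GMap gJ).
by apply: (can_inj fK); rewrite gK gmapJ gK.
Qed.

Lemma bij_surj (X Y : finType) (f : X -> Y) :
  bijective f -> forall y, exists x, f x = y.
Proof. by case=> g _ gK y; exists (g y). Qed.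

Section SubLift.
Variables (X Y : gset G) (P : pred X) (PJ : forall x a, P x -> P (x <* a)).
Variables (f : gmap Y X) (fP : forall y, P (f y)).
Lemma sub_liftJ y a :
  (exist _ (f (y <* a)) (fP (y <* a)) : subg PJ) = (exist _ (f y) (fP y) : subg PJ) <* a.
Proof. by apply: val_inj; rewrite /= gmapJ. Qed.
Definition sub_lift : gmap Y (subg PJ) := GMap sub_liftJ.
End SubLift.

(** Matching the enumerations of the two fibres over each point of K gives the
    bijection. *)
Lemma fibre_bijection (A A' K : finType) (k : A -> K) (k' : A' -> K) :
  (forall y, #|[set a | k a == y]| = #|[set a | k' a == y]|) ->
  exists2 phi : A -> A', bijective phi & forall a, k' (phi a) = k a.
Proof.
move=> hc.
pose fib y : {set A} := [set a | k a == y].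
pose fib' y : {set A'} := [set a | k' a == y].
have inF a : a \in fib (k a) by rewrite inE.
pose psi y a (h : a \in fib y) : A' :=
  enum_val (cast_ord (hc y) (enum_rank_in h a)).
have psiE y a (h : a \in fib y) : k' (psi y a h) = y.
  have : psi y a h \in fib' y by exact: enum_valP.
  by rewrite inE => /eqP.
have psiI y a b (h : a \in fib y) (h' : b \in fib y) : psi y a h = psi y b h' -> a = b.
  by move=> /enum_val_inj /cast_ord_inj /(enum_rank_in_inj h h'); apply.
have phiI : injective (fun a => psi (k a) a (inF a)).
  move=> a b e; have ek : k a = k b by rewrite -(psiE _ _ (inF a)) e psiE.
  move: (inF a) (inF b) e; rewrite ek => ha hb; exact: psiI.
exists (fun a => psi (k a) a (inF a)); last by move=> a; exact: psiE.
apply: inj_card_bij => //.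
rewrite -[X in (_ <= X)%N]sum1_card (partition_big k predT) //=.
rewrite -[X in (X <= _)%N]sum1_card (partition_big k' predT) //=.
by apply: leq_sum => y _; rewrite !sum1_card; have := hc y; rewrite !cardsE => ->.
Qed.

(** A map from X to G/e is the same thing as an equivariant family of group
    elements, which is how freeness of X will be used. *)
Lemma orbit1_translation X (e : gmap X (orbitg 1%G)) :
  exists r : X -> G, forall x a, r (x <* a) = (r x * a)%g.
Proof.
exists (fun x => repr (val (e x))) => x a; rewrite gmapJ /=.
case: (e x) => C /= /rcosetsP[c _ ->].
by rewrite -rcosetM !mul1g !repr_set1.
Qed.

Lemma orbit1_free (C : orbitg (G := G) 1%G) a : C <* a = C -> a = 1%g.
Proof.
have [r rJ] := orbit1_translation (gid (orbitg (G := G) 1%G)).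
by move=> /(congr1 r); rewrite rJ => /(canRL (mulKg _)); rewrite mulVg.
Qed.
End FiniteGSetTools.

(** * Maps lying in every indexing category *)

Section StabilizerPreserving.
Variables (G : finGroupType) (O : indexing_category G).
Implicit Types X Y Z : gset G.

Lemma ic_ext X Y (f g : gmap X Y) : f =1 g -> ic_mem O f -> ic_mem O g.
Proof.
move=> e; apply: (@ic_pullback _ O _ _ _ _ g (gid X) f (gid Y)).
split=> [x|U u v euv]; first by rewrite /= e.
by exists v; split=> // x; rewrite -e -euv.
Qed.

Lemma ic_bij X Y (f : gmap X Y) : bijective f -> ic_mem O f.
Proof.
move=> /bij_gmap_inv[g [fK gK]].
apply: (@ic_pullback _ O _ _ _ _ f f (gid Y) (gid Y)); last exact: ic_id.
split=> // U u v euv; exists (gcomp g u); split=> [x|x|w' ew _ x] /=.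
- exact: gK.
- by rewrite gK -[RHS]euv.
- by rewrite -ew fK.
Qed.

(** The target is the disjoint union of the image and its complement, so an
    injection is a coprojection up to isomorphism. *)
Lemma ic_inj X Y (f : gmap X Y) : injective f -> ic_mem O f.
Proof.
move=> fI; pose P := [pred y | y \notin codom f].
have PJ y a : P y -> P (y <* a).
  apply: contra => /codomP[x e]; apply/codomP; exists (x <* a^-1%g).
  by rewrite gmapJ -e gopK.
pose v := gcopair f (subg_val PJ).
have vB : bijective v.
  apply: inj_surj_bij => [[x|[y Py]] [x'|[y' Py']] /= e|y].
  - by rewrite (fI _ _ e).
  - by case/negP: Py'; rewrite -e codom_f.
  - by case/negP: Py; rewrite e codom_f.
  - by congr inr; apply: val_inj.
  case Py : (P y); first by exists (inr (exist _ y Py)).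
  by move/negbFE/codomP: Py => [x ->]; exists (inl x).
apply: (@ic_ext _ _ (gcomp v (ginl _ _))) => //.
by apply: ic_comp; [exact: ic_bij|exact: ic_inl].
Qed.

(** The stabilizer-preserving maps form the smallest indexing category: such a
    map is injective on each orbit, hence a finite copairing of injections. *)
Lemma ic_stabilizer_preserving X Y (f : gmap X Y) :
  (forall x a, f x <* a = f x -> x <* a = x) -> ic_mem O f.
Proof.
have [n] := ubnP #|X|; elim: n X f => // n IHn X f /ltnSE leXn fS.
suff [P [Q [u uB uO]]] : exists (P Q : gset G), exists2 u : gmap (sumg P Q) X,
    bijective u & ic_mem O (gcomp f u).
  have [v [uK vK]] := bij_gmap_inv uB.
  apply: (@ic_ext _ _ (gcomp (gcomp f u) v)) => [x|]; first by rewrite /= vK.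
  by apply: ic_comp => //; apply: ic_bij; exists u.
case: (pickP (mem X)) => [x0 _|X0]; last first.
  exists (emptyg G), (emptyg G), (gcopair (from_empty X) (from_empty X)).
    by apply: inj_surj_bij => [[]//|x]; have := X0 x.
  apply: (@ic_ext _ _ (gcopair (from_empty Y) (from_empty Y))); first by do 2!case.
  by apply: ic_copair; exact: ic_empty.
pose P := [pred x : X | [exists a, x == x0 <* a]].
have PJ x a : P x -> P (x <* a).
  by case/existsP=> b /eqP->; apply/existsP; exists (b * a)%g; rewrite gopM.
have nPJ x a : ~~ P x -> ~~ P (x <* a) by rewrite (gopV_inv PJ).
exists (Defs.subg PJ), (Defs.subg nPJ), (gcopair (subg_val PJ) (subg_val nPJ)).
  apply: inj_surj_bij => [[[x Px]|[x Px]] [[y Py]|[y Py]] /= e|x].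
  - by congr inl; apply: val_inj.
  - by case/negP: (Py); rewrite -e.
  - by case/negP: (Px); rewrite e.
  - by congr inr; apply: val_inj.
  by case Px : (P x); [exists (inl (exist _ x Px))|exists (inr (exist _ x (negbT Px)))].
apply: (@ic_ext _ _ (gcopair (gcomp f (subg_val PJ)) (gcomp f (subg_val nPJ)))).
  by case.
apply: ic_copair.
  apply: ic_inj => -[x Px] [y Py] /= e; apply: val_inj => /=.
  have [/existsP[a /eqP xE] /existsP[b /eqP yE]] := (Px, Py).
  move: e; rewrite {}xE {}yE !gmapJ => e.
  have := fS x0 (a * b^-1)%g; rewrite !gopM e gopK => /(_ erefl) h.
  by rewrite -{2}h gopVK.
apply: IHn => [|[x Px] a /= /fS e]; last exact: val_inj.
apply: leq_trans leXn; rewrite card_sig; apply: proper_card; apply/properP.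
split; first exact/subsetP.
exists x0 => //; rewrite inE negbK /=; apply/existsP; exists 1%g.
by rewrite gop1.
Qed.
End StabilizerPreserving.

(** * Subgroups and group completions *)

Section Additive.
Variables (V W : zmodType) (f : V -> W).
Hypothesis fD : {morph f : x y / x + y}.
Lemma additive0 : f 0 = 0.
Proof. by apply: (addrI (f 0)); rewrite -fD !addr0. Qed.
Lemma additiveB : {morph f : x y / x - y}.
Proof. by move=> x y; apply: (addIr (f y)); rewrite -fD !subrK. Qed.
End Additive.

(** Membership is a proposition, so that predicates quantifying over all
    finite G-sets qualify; the type of members decides it classically. *)
Record subgroup (V : zmodType) := Subgroup {
  in_sub :> V -> Prop;
  in_sub0 : in_sub 0;
  in_subB : forall x y, in_sub x -> in_sub y -> in_sub (x - y)
}.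

Section SubgroupType.
Variables (V : zmodType) (P : subgroup V).
Definition sub_pred : {pred V} := fun x => `[< P x >].
Lemma sub_pred_closed : zmod_closed sub_pred.
Proof.
split=> [|x y /asboolP Px /asboolP Py]; apply/asboolP; first exact: in_sub0.
exact: in_subB.
Qed.
HB.instance Definition _ := GRing.isZmodClosed.Build V sub_pred sub_pred_closed.
Definition sub_type := {x : V | sub_pred x}.
HB.instance Definition _ := [isSub of sub_type for @sval V sub_pred].
HB.instance Definition _ := [Choice of sub_type by <:].
HB.instance Definition _ := [SubChoice_isSubZmodule of sub_type by <:].

Lemma sub_typeP (x : sub_type) : P (val x).
Proof. by apply/asboolP; exact: (valP x). Qed.
Definition to_sub x (Px : P x) : sub_type := exist _ x (asboolT Px).
End SubgroupType.

Section GroupCompletion.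
Variables (M : Type) (eqM : M -> M -> Prop) (addM : M -> M -> M).
Variables (V : zmodType) (u : M -> V).
Hypothesis uV : is_group_completion eqM addM u.

Lemma completion_ext (W : zmodType) (f f' : V -> W) :
  {morph f : x y / x + y} -> {morph f' : x y / x + y} ->
  (forall a, f (u a) = f' (u a)) -> f =1 f'.
Proof.
have [ue ua uU] := uV; move=> fD f'D e.
have [g [gD ge gU]] := uU W (f \o u) (fun a b h => congr1 f (ue a b h))
  (fun a b => etrans (congr1 f (ua a b)) (fD _ _)).
by move=> x; rewrite (gU f) // (gU f') // => a; rewrite -e.
Qed.

(** The values of the universal map lie in any subgroup containing them, so
    the completion maps to that subgroup, and uniqueness makes this a
    retraction of the inclusion. *)
Lemma completion_ind (P : subgroup V) : (forall a, P (u a)) -> forall x, P x.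
Proof.
have [ue ua uU] := uV; move=> Pu.
have [|a b|f [fD fu _]] := uU (sub_type P) (fun a => to_sub (Pu a)).
- by move=> a b /ue e; apply: val_inj.
- by apply: val_inj; rewrite /= ua.
move=> x; have -> : x = val (f x); last exact: sub_typeP.
apply: (@completion_ext V id (val \o f)) x => // [x y|a]; rewrite /=.
  by rewrite fD.
by rewrite fu.
Qed.
End GroupCompletion.

(** * Mackey functors *)

Section MackeyTools.
Variables (G : finGroupType) (M : mackey G).
Implicit Types X Y Z : gset G.

Lemma mmap0 X Y (s : span X Y) : mmap s (0 : M X) = 0.
Proof. exact: (additive0 (@mmapD _ _ _ _ s)). Qed.

Lemma mmap_ext X Y S (f f' : gmap S X) (h h' : gmap S Y) (x : M X) :
  f =1 f' -> h =1 h' -> mmap (Span f h) x = mmap (Span f' h') x.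
Proof. by move=> ef eh; exact: (phi_ext (@mmap_iso G M) ef eh). Qed.

(** Any pullback square computes the composite of two spans, not only the chosen
    one; all identities between composites of restrictions and transfers below
    are obtained by exhibiting such a square. *)
Lemma mmap_cart X Y Z S S' S2 (f : gmap S X) (h : gmap S Y) (f' : gmap S' Y)
    (h' : gmap S' Z) (f2 : gmap S2 X) (h2 : gmap S2 Z) (a : gmap S2 S)
    (b : gmap S2 S') (x : M X) :
  is_cart a b f' h -> (forall u, f2 u = f (a u)) -> (forall u, h2 u = h' (b u)) ->
  mmap (Span f' h') (mmap (Span f h) x) = mmap (Span f2 h2) x.
Proof.
move=> c ef eh.
rewrite (phi_cart (@mmap_iso G M) (@mmap_comp G M) (s := Span f h) (t := Span f' h') x c).
by apply: mmap_ext => u; rewrite ?ef ?eh.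
Qed.

Lemma mmap_self X (s : span X X) (x : M X) :
  bijective (sf s) -> sh s =1 sf s -> mmap s x = x.
Proof.
move=> fB e; rewrite -[RHS](mmap_id x); apply: mmap_iso.
by exists (sf s : gmap _ (sS (span_id X))); split=> // y; rewrite e.
Qed.

(** An empty span is isomorphic to its own double, so it acts by an element c
    with c = c + c. *)
Lemma mmap_empty X Y (s : span X Y) (x : M X) :
  (sS s -> False) -> mmap s x = 0.
Proof.
move=> s0; apply: (addrI (mmap s x)); rewrite addr0 -mmap_add; apply/esym/mmap_iso.
exists (ginl _ _); split=> //; apply: inj_surj_bij => [u v [] //|].
by case=> u; case: (s0 u).
Qed.

(** The identity span of X is the sum of the spans K d = K d over X, since
    X is the disjoint union of the K d; the induction adds one piece at a
    time. *)
Lemma mmap_partition X (deg : X -> nat) (n : nat) (K : nat -> gset G)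
    (q : forall d, gmap (K d) X) (x : M X) :
  (forall y, deg y < n)%N -> (forall d, injective (q d)) ->
  (forall d y, deg (q d y) = d) -> (forall y, exists z, q (deg y) z = y) ->
  x = \sum_(d < n) mmap (Span (q d) (q d)) x.
Proof.
move=> degn qI degq qS.
have degJ y a : deg (y <* a) = deg y by have [z {1}<-] := qS y; rewrite -gmapJ degq.
have PJ m y a : (deg y < m)%N -> (deg (y <* a) < m)%N by rewrite degJ.
(* L m is the part of x supported where deg is below m. *)
pose L m := mmap (Span (subg_val (PJ m)) (subg_val (PJ m))) x.
rewrite [LHS](_ : x = L n); last first.
  apply/esym/mmap_self => //; apply: inj_surj_bij => [y z|y]; first exact: val_inj.
  by exists (exist _ y (degn y)).
elim: (n) => [|m IHm].
  by rewrite big_ord0; apply: mmap_empty => -[].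
rewrite big_ord_recr /= -IHm -mmap_add; apply: mmap_iso.
have lt1 (z : Defs.subg (PJ m)) : (deg (subg_val (PJ m) z) < m.+1)%N.
  exact: ltnW (valP z).
have lt2 z : (deg (q m z) < m.+1)%N by rewrite degq.
pose v : gmap (sumg (Defs.subg (PJ m)) (K m)) (Defs.subg (PJ m.+1)) :=
  gcopair (sub_lift (PJ m.+1) lt1) (sub_lift (PJ m.+1) lt2).
have vB : bijective v.
  apply: inj_surj_bij => [[[y ym]|y] [[z zm]|z] /= [e]|[y ym]].
  - by congr inl; apply: val_inj.
  - by have := degq m z; rewrite -e => ez; have := ym; rewrite ez ltnn.
  - by have := degq m y; rewrite e => ez; have := zm; rewrite ez ltnn.
  - by congr inr; exact: qI.
  have := ym; rewrite ltnS leq_eqVlt => /orP[/eqP e|ym'].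
    have [z zy] := qS y; rewrite e in z zy.
    by exists (inr z); apply: val_inj.
  by exists (inl (exist _ y ym')); apply: val_inj.
have [w [vK wK]] := bij_gmap_inv vB.
exists w; split=> [|y|y]; first by exists v.
  by rewrite -{2}(wK y); case: (w y).
by rewrite -{2}(wK y); case: (w y).
Qed.

End MackeyTools.

Lemma mm0 (G : finGroupType) (M N : mackey G) (f : mackey_map M N) X :
  mm f (0 : M X) = 0.
Proof. exact: (additive0 (@mmD _ _ _ f X)). Qed.
Lemma mmB (G : finGroupType) (M N : mackey G) (f : mackey_map M N) X (x y : M X) :
  mm f (x - y) = mm f x - mm f y.
Proof. exact: (additiveB (@mmD _ _ _ f X)). Qed.

Section Shift.
Variables (G : finGroupType) (T : gset G) (M : mackey G).
Implicit Types X Y Z : gset G.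

Definition shift_val X : zmodType := M (prodg T X).
Definition shift_map X Y (s : span X Y) : shift_val X -> shift_val Y :=
  mmap (span_prod (span_id T) s).

Lemma shift_mapD X Y (s : span X Y) : {morph shift_map s : x y / x + y}.
Proof. by move=> x y; exact: mmapD. Qed.

Lemma shift_iso X Y (s t : span X Y) : span_iso s t ->
  shift_map s =1 shift_map t.
Proof.
case=> u [uB uf uh]; apply: mmap_iso; exists (prod_gmap (gid T) u); split.
- have [v uK vK] := uB; exists (fun z => (z.1, v z.2)) => -[t0 x] /=.
    by rewrite uK.
  by rewrite vK.
- by case=> t0 x /=; rewrite uf.
- by case=> t0 x /=; rewrite uh.
Qed.

Lemma shift_id X : shift_map (span_id X) =1 id.
Proof. by move=> x; apply: mmap_self => //; exists id; case. Qed.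

Lemma shift_comp X Y Z (s : span X Y) (t : span Y Z) (x : shift_val X) :
  shift_map (span_comp s t) x = shift_map t (shift_map s x).
Proof.
apply/esym/(mmap_cart (a := prod_gmap (gid T) (pb1 (f := sh s) (g := sf t)))
  (b := prod_gmap (gid T) pb2)) => //.
split=> [[t0 z]|[t0 z] [t1 z'] /= [-> e1] [e2]|[t0 u] [t1 v] /= [-> e]].
- by congr pair; exact: pbE.
- by congr pair; exact: pb_inj.
- by exists (t1, pb_elt e).
Qed.

Lemma shift_add X Y (s t : span X Y) (x : shift_val X) :
  shift_map (span_add s t) x = shift_map s x + shift_map t x.
Proof.
rewrite -[RHS]mmap_add; apply/esym/mmap_iso.
exists (gcopair (prod_gmap (gid T) (ginl _ _)) (prod_gmap (gid T) (ginr _ _))).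
split=> [|[] [] //|[] [] //].
apply: inj_surj_bij => [[[t0 z]|[t0 z]] [[t1 z']|[t1 z']] //= [-> ->]//|].
by case=> t0 [z|z]; [exists (inl (t0, z))|exists (inr (t0, z))].
Qed.

(** The internal hom out of the representable functor of T, which is also its
    box product with M because T is self-dual. *)
Definition shift : mackey G :=
  Mackey shift_mapD shift_iso shift_id shift_comp shift_add.
End Shift.

Record submackey (G : finGroupType) (M : mackey G) := Submackey {
  in_subm :> forall X : gset G, subgroup (M X);
  in_subm_map : forall X Y (s : span X Y) x, in_subm X x -> in_subm Y (mmap s x)
}.

Section SubmackeyFunctor.
Variables (G : finGroupType) (M : mackey G) (P : submackey M).
Implicit Types X Y Z : gset G.

Definition subm_val X : zmodType := sub_type (P X).
Definition subm_map X Y (s : span X Y) (x : subm_val X) : subm_val Y :=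
  to_sub (in_subm_map s (sub_typeP x)).

Lemma subm_mapD X Y (s : span X Y) : {morph subm_map s : x y / x + y}.
Proof. by move=> x y; apply: val_inj; rewrite /= mmapD. Qed.
Lemma subm_iso X Y (s t : span X Y) : span_iso s t -> subm_map s =1 subm_map t.
Proof. by move=> st x; apply: val_inj; exact: mmap_iso. Qed.
Lemma subm_id X : subm_map (span_id X) =1 id.
Proof. by move=> x; apply: val_inj; exact: mmap_id. Qed.
Lemma subm_comp X Y Z (s : span X Y) (t : span Y Z) x :
  subm_map (span_comp s t) x = subm_map t (subm_map s x).
Proof. by apply: val_inj; exact: mmap_comp. Qed.
Lemma subm_add X Y (s t : span X Y) x :
  subm_map (span_add s t) x = subm_map s x + subm_map t x.
Proof. by apply: val_inj; rewrite /= mmap_add. Qed.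

Definition subm : mackey G := Mackey subm_mapD subm_iso subm_id subm_comp subm_add.

Definition subm_incl : mackey_map subm M.
Proof. by exists (fun X (x : sub_type (P X)) => val x). Defined.
End SubmackeyFunctor.

Definition mackey_id (G : finGroupType) (M : mackey G) : mackey_map M M.
Proof. by exists (fun X x => x). Defined.
Definition mackey_comp (G : finGroupType) (M N P : mackey G)
  (g : mackey_map N P) (f : mackey_map M N) : mackey_map M P.
Proof.
exists (fun X x => mm g (mm f x)) => [X x y|X Y s x].
  by rewrite !mmD.
by rewrite !mm_nat.
Defined.

Section BoxInduction.
Variables (G : finGroupType) (M N B : mackey G).
Variable th : forall X Y, M X -> N Y -> B (prodg X Y).
Hypothesis thB : is_box th.

(** A box product has no proper Mackey subfunctor containing all products
    th a b: the universal map to such a subfunctor is, by uniqueness, a section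
    of its inclusion. *)
Lemma box_ind (P : submackey B) :
  (forall X Y (a : M X) (b : N Y), P _ (th a b)) -> forall X (x : B X), P X x.
Proof.
have [[thl thr thn] thU] := thB; move=> Pth.
have [|f [fth _]] := thU (subm P) (fun X Y a b => to_sub (Pth X Y a b)).
  split=> [X Y b a a'|X Y a b b'|X X' Y Y' s t a b]; apply: val_inj => /=.
  - exact: thl.
  - exact: thr.
  - exact: thn.
have [g [_ gU]] := thU B th (proj1 thB).
move=> X x; have -> : x = val (mm f x : sub_type (P X)); last exact: sub_typeP.
have e1 := gU (mackey_id B) (fun _ _ _ _ => erefl) X x.
have e2 : val (mm f x : sub_type (P X)) = mm g x.
  apply: (gU (mackey_comp (subm_incl P) f)) => X' Y' a b /=.
  by rewrite fth.
by rewrite e2 -e1.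
Qed.
End BoxInduction.

(** * Restrictions and transfers in a Tambara functor *)

Section TambaraTools.
Variables (G : finGroupType) (O : indexing_category G) (R : tambara O).
Implicit Types X Y Z : gset G.

Lemma ts_RR X Y Z (f : gmap Y X) (g : gmap Z Y) (x : R X) :
  tR g (tR f x) = tR (gcomp f g) x.
Proof. exact: (phi_RR (@ts_iso G O R) (@ts_comp G O R)). Qed.

Lemma ts_TT X Y Z (f : gmap X Y) (g : gmap Y Z) (x : R X) :
  tT g (tT f x) = tT (gcomp g f) x.
Proof. exact: (phi_TT (@ts_iso G O R) (@ts_comp G O R)). Qed.

Lemma ts_TR X Y S (f : gmap S X) (h : gmap S Y) (x : R X) :
  ts (Span f h) x = tT h (tR f x).
Proof. exact: (phi_TR (@ts_iso G O R) (@ts_comp G O R)). Qed.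

Lemma ts_RT X Y Z W (a : gmap X Z) (b : gmap X Y) (g : gmap Y W) (h : gmap Z W)
    (x : R Z) :
  is_cart a b g h -> tR g (tT h x) = tT b (tR a x).
Proof. by move=> c; exact: (phi_RT (@ts_iso G O R) (@ts_comp G O R) x c). Qed.

Lemma ts_ext X Y S (f f' : gmap S X) (h h' : gmap S Y) (x : R X) :
  f =1 f' -> h =1 h' -> ts (Span f h) x = ts (Span f' h') x.
Proof. by move=> ef eh; exact: (phi_ext (@ts_iso G O R) ef eh). Qed.

Lemma ts_T_ext X Y (h h' : gmap X Y) (x x' : R X) :
  h =1 h' -> x = x' -> tT h x = tT h' x'.
Proof. by move=> e ->; exact: ts_ext. Qed.

Lemma ts_R1 X (f : gmap X X) (x : R X) : f =1 id -> tR f x = x.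
Proof. exact: (phi_R1 (@ts_iso G O R) (@ts_id G O R)). Qed.

Lemma ts_Tinv X Y (h : gmap X Y) (k : gmap Y X) (x : R X) :
  cancel h k -> cancel k h -> tT h x = tR k x.
Proof. by move=> hK kK; exact: (phi_Tinv (@ts_iso G O R) x hK kK). Qed.

Lemma ts0 X Y (s : span X Y) : ts s (0 : R X) = 0.
Proof. exact: (@mmap0 G (mackey_of R)). Qed.

Lemma frobenius_r X Y (h : gmap X Y) (a : R Y) (b : R X) :
  a * tT h b = tT h (tR h a * b).
Proof. by rewrite mulrC frobenius mulrC. Qed.

(** If [E] is invertible in R(G/G), then every x in R(X) is recovered from its
    restriction to E x X, because T_snd R_snd is multiplication by [E]. *)
Lemma transfer_restrict (E X : gset G) (r : R (pointg G)) (x : R X) :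
  tT (to_point E) 1 * r = 1 ->
  tT (gsnd E X) (tR (gsnd E X) x) * tR (to_point X) r = x.
Proof.
move=> Er; rewrite -[X in tT _ X]mul1r -frobenius -mulrA [x * _]mulrC mulrA.
rewrite -(tR_one R (gfst E X)).
rewrite -(@ts_RT _ _ _ _ (gfst E X) (gsnd E X) (to_point X) (to_point E)).
  by rewrite -tR_mul Er tR_one mul1r.
by split=> // [[e y] [e' y'] /= -> ->//|e y _]; exists (e, y).
Qed.
End TambaraTools.

(** * The module S(T x -) *)

Section ShiftModule.
Variables (G : finGroupType) (O : indexing_category G) (S : tambara O).
Variable T : gset G.
Implicit Types X Y Z : gset G.
Local Notation N := (shift T (mackey_of S)).

Definition shift_pr1 X Y : gmap (prodg T (prodg X Y)) X :=
  gcomp (gfst X Y) (gsnd _ _).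
Definition shift_pr2 X Y : gmap (prodg T (prodg X Y)) (prodg T Y) :=
  gpair (gfst _ _) (gcomp (gsnd X Y) (gsnd _ _)).
Definition shift_act X Y (a : S X) (m : S (prodg T Y)) : S (prodg T (prodg X Y)) :=
  tR (shift_pr1 X Y) a * tR (shift_pr2 X Y) m.

(** The action is an external product up to a reordering of factors, hence
    natural because the external product is. *)
Lemma shift_actE X Y (a : S X) (m : S (prodg T Y)) :
  shift_act a m = tR (gpair (shift_pr1 X Y) (shift_pr2 X Y)) (ext_mul a m).
Proof.
by rewrite /ext_mul tR_mul !ts_RR; congr (_ * _); exact: ts_ext.
Qed.

Lemma shift_act_pairing :
  is_pairing (M := green_of S) (N := N) (P := N) shift_act.
Proof.
split=> [X Y b a a'|X Y a b b'|X X' Y Y' [K f h] [K' f' h'] a b] /=.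
- by rewrite /shift_act tR_add mulrDl.
- by rewrite /shift_act [tR _ (_ + _)]tR_add mulrDr.
have [_ _ nat] := ext_mul_pairing S.
rewrite !shift_actE [ext_mul _ _]nat.
pose S2 := prodg T (prodg K K').
pose f2 : gmap S2 (prodg X (prodg T Y)) :=
  gpair (gcomp f (shift_pr1 _ _)) (gcomp (prod_gmap (gid T) f') (shift_pr2 _ _)).
pose h2 : gmap S2 (prodg T (prodg X' Y')) := prod_gmap (gid T) (prod_gmap h h').
transitivity (mmap (m := mackey_of S) (Span f2 h2) (ext_mul a b)).
  apply: (mmap_cart (M := mackey_of S)
    (a := gpair (shift_pr1 _ _) (shift_pr2 _ _)) (b := h2)) => //.
  split=> [[t [k k']]//|[t [k k']] [u [l l']] /= [-> -> ->]//|].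
  move=> [k [t k']] [t' [x y]] /= [<- <- <-]; by exists (t, (k, k')).
apply/esym; apply: (mmap_cart (M := mackey_of S)
    (a := prod_gmap (gid T) (prod_gmap f f')) (b := gid S2)) => //.
by split=> // [[t [x y]]] v /= ->; exists v.
Qed.

Lemma shift_mapE X Y K (f : gmap K X) (h : gmap K Y) (m : S (prodg T X)) :
  shift_map (M := mackey_of S) (Span f h) m =
  tT (prod_gmap (gid T) h) (tR (prod_gmap (gid T) f) m).
Proof. exact: ts_TR. Qed.

Lemma shift_mapT X Y (h : gmap X Y) (m : S (prodg T X)) :
  shift_map (M := mackey_of S) (spanT h) m = tT (prod_gmap (gid T) h) m.
Proof. by apply: ts_ext => // -[]. Qed.

Lemma shift_mapR X Y (f : gmap Y X) (m : S (prodg T X)) :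
  shift_map (M := mackey_of S) (spanR f) m = tR (prod_gmap (gid T) f) m.
Proof. by apply: ts_ext => // -[]. Qed.

Lemma shift_actA X Y Z (a : S X) (b : S Y) (c : S (prodg T Z)) :
  shift_map (M := mackey_of S) (T := T) (spanT (gassoc X Y Z)) (shift_act (ext_mul a b) c) =
  shift_act a (shift_act b c).
Proof.
rewrite shift_mapT (@ts_Tinv _ _ _ _ _ _ (prod_gmap (gid T) (gassocV X Y Z)));
  [|by case=> ? [[]]|by case=> ? [? []]].
rewrite /shift_act /ext_mul !tR_mul !ts_RR -mulrA; congr (_ * (_ * _)); exact: ts_ext.
Qed.

Lemma shift_act1 X (m : S (prodg T X)) :
  shift_map (M := mackey_of S) (T := T) (spanT (gsnd (pointg G) X)) (shift_act 1 m) = m.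
Proof.
rewrite shift_mapT (@ts_Tinv _ _ _ _ _ _ (prod_gmap (gid T) (gpair (to_point X) (gid X))));
  [|by case=> ? [[]]|by case].
by rewrite /shift_act !tR_mul !ts_RR tR_one mul1r ts_R1 // => -[].
Qed.

Definition shift_module : gmodule (green_of S) :=
  @GModule _ (green_of S) N shift_act shift_act_pairing shift_actA shift_act1.
End ShiftModule.

(** * The Burnside functor and free modules *)

Section Burnside.
Variables (G : finGroupType) (O : indexing_category G) (A : tambara O).
Variable ioA : forall X : gset G, gset_over X -> A X.
Hypothesis hA : is_burnside ioA.
Implicit Types X Y Z : gset G.

Lemma burnside_iso X (u v : gset_over X) : gover_iso u v -> ioA u = ioA v.
Proof. by have [/(_ X)[e _ _] _] := hA; exact: e. Qed.

(** The unit is the norm along the empty set over X of the only element of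
    A(emptyset), and the dependent product of an empty family is a point. *)
Lemma burnside_id X : ioA (GOver (gid X)) = 1.
Proof.
have [_ nat] := hA.
rewrite -tone [X in tmap _ X](@tmap_empty _ _ _ _ (ioA (GOver (gid (emptyg G))))).
rewrite -nat; apply: burnside_iso.
pose p := pb2 (f := gid (emptyg G)) (g := gid (emptyg G)).
pose g := from_empty X.
have setP x : pi_pred p g (x, set0).
  apply/andP; split; first by apply/forall_inP => b; rewrite inE.
  by apply/forallP => -[].
pose u0 (x : X) : pi p g := exist _ (x, set0) (setP x).
have u0J x a : u0 (x <* a) = u0 x <* a.
  by apply: val_inj; congr pair; rewrite /= /gop /= /pow_act imset0.
exists (GMap u0J : gmap (gov (GOver (gid X))) (gov (GOver _))); split=> //.
apply: inj_surj_bij => [x y /(congr1 val)[]//|z].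
by exists (pi_str p g z); apply: pi_ext => // b; rewrite inE.
Qed.

(** The dependent product along an identity map changes nothing, so for a span
    only the pullback and the composition remain. *)
Lemma burnside_span X Y (s : span X Y) (u : gset_over X) :
  ts s (ioA u) = ioA (GOver (gcomp (sh s) (pb2 (f := gov_map u) (g := sf s)))).
Proof.
have [_ nat] := hA; rewrite /ts -nat; apply/esym/burnside_iso.
pose p := pb2 (f := gov_map u) (g := sf s).
have setP x : pi_pred p (gid (sS s)) (p x, [set x]).
  apply/andP; split; first by apply/forall_inP => b /set1P->.
  apply/forallP => c; apply/implyP => /eqP/= ->; apply/cards1P; exists x.
  by apply/setP => b; rewrite !inE; case: eqP => // ->; rewrite eqxx.
pose u0 x : pi p (gid (sS s)) := exist _ (p x, [set x]) (setP x).
have u0J x a : u0 (x <* a) = u0 x <* a.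
  by apply: val_inj; congr pair; rewrite /= /gop /= /pow_act imset_set1.
exists (GMap u0J : gmap (gov (GOver (gcomp (sh s) p))) (gov (GOver _))); split=> //.
apply: inj_surj_bij => [x y /(congr1 val)[_ /set1_inj]//|z].
have [b /andP[bz /eqP ez]] := pi_sec_ex (erefl : gid _ (pi_str p (gid _) z) = _).
exists b; apply: pi_ext; first exact: ez.
by move=> b'; rewrite inE => /eqP->.
Qed.

Lemma burnsideE X K (h : gmap K X) : ioA (GOver h) = tT h 1.
Proof.
rewrite -burnside_id burnside_span; apply: burnside_iso.
have e x : gid K (gid K x) = gid K (gid K x) by [].
exists (pb_lift e : gmap (gov (GOver h)) (gov (GOver _))); split=> //.
exists (pb1 (f := gid K) (g := gid K)) => // z; apply: pb_inj => //; exact: (pbE z).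
Qed.

Section Representable.
Variable T : gset G.
Local Notation Q := (shift T (mackey_of A)).

(** Spans T <- S -> X are finite G-sets over T x X, so A(T x -) represents T. *)
Definition span_class X (s : span T X) : Q X := ioA (GOver (gpair (sf s) (sh s))).

Lemma span_classE X (s : span T X) : span_class s = tT (gpair (sf s) (sh s)) 1.
Proof. exact: burnsideE. Qed.

Lemma span_class_completion X :
  is_group_completion (@span_iso G T X) (@span_add G T X) (@span_class X).
Proof.
have [/(_ (prodg T X))[ie ia iU] _] := hA; split=> [s t|s t|W v ve va].
- case=> u [uB uf uh]; apply: ie; exists u; split=> // x /=.
  by rewrite uf uh.
- rewrite /span_class -ia; apply: ie; exists (gid _ : gmap (gov (GOver _)) (gov (GOver _))).
  by split=> [|[]//]; exists id.
pose v' (u : gset_over (prodg T X)) : W :=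
  v (Span (gcomp (gfst T X) (gov_map u)) (gcomp (gsnd T X) (gov_map u))).
have v'E s : v' (GOver (gpair (sf s) (sh s))) = v s.
  by apply: ve; exists (gid _ : gmap (sS (Span _ _)) (sS s)); split=> //; exists id.
have [u w [h [hB he]]|u w|f [fD fu fU]] := iU W v'.
- by apply: ve; exists (h : gmap (sS (Span _ _)) (sS (Span _ _))); split=> // x /=; rewrite he.
- rewrite -va; apply: ve.
  exists (gid _ : gmap (sS (Span _ _)) (sS (Span _ _))).
  by split=> [|[]//|[]//]; exists id.
exists f; split=> // [s|f' f'D f's]; first by rewrite fu.
apply: fU => // u; rewrite -[RHS]f's; congr f'; apply: ie.
exists (gid _ : gmap (gov (GOver _)) (gov (GOver _))); split=> [|x]; first by exists id.
by rewrite /=; case: (gov_map u x).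
Qed.

Lemma span_class_representable : is_representable span_class.
Proof.
split=> [X|X Y s t]; first exact: span_class_completion.
rewrite [RHS]burnside_span; apply: burnside_iso.
have e0 (x : pb (sh s) (sf t)) : gpair (sf s) (sh s) (pb1 x) =
    prod_gmap (gid T) (sf t) (gpair (gcomp (sf s) pb1) pb2 x).
  by congr pair; exact: pbE.
pose u0 := pb_lift e0.
exists (u0 : gmap (gov (GOver _)) (gov (GOver _))); split=> //.
apply: inj_surj_bij => [x y e|z].
  apply: pb_inj; first exact: (congr1 pb1 e).
  exact: (congr1 snd (congr1 pb2 e)).
case: z => -[k [t0 k']] zP; have [e1 e2] := eqP zP; exists (pb_elt e2).
by apply: val_inj; rewrite /= e1.
Qed.

Lemma span_class_map X (s : span T X) :
  span_class s = mmap s (span_class (span_id T)).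
Proof.
have [_ nat] := span_class_representable.
rewrite -nat; have [e _ _] := span_class_completion X; apply: e.
have ex x : gid T (sf s x) = sf s (gid (sS s) x) by [].
exists (pb_lift (f := sh (span_id T)) ex : gmap (sS s) (sS (span_comp _ _))); split=> //.
exists (pb2 (f := gid T) (g := sf s)) => // z; apply: pb_inj => //.
exact/esym/(pbE z).
Qed.
End Representable.

Section FreeModule.
Variables (S : tambara O) (l : tambara_map A S) (T : gset G).
Local Notation N := (shift_module S T).
Local Notation Q := (shift T (mackey_of A)).

Lemma burnside_unitE X K (h : gmap K X) : tm l (tT h 1 : A X) = tT h 1.
Proof. by rewrite [LHS]tm_nat tm_one. Qed.

Definition span_pairing X Y (a : S X) (b : A (prodg T Y)) : S (prodg T (prodg X Y)) :=
  shift_act a (tm l b).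

Lemma span_pairing_pairing :
  is_pairing (M := green_of S) (N := Q) (P := N) span_pairing.
Proof.
have [hl hr hn] := shift_act_pairing S T.
split=> [X Y b a a'|X Y a b b'|X X' Y Y' s t a b] /=.
- exact: hl.
- by rewrite /span_pairing tm_add; exact: hr.
- by rewrite /span_pairing [tm l _]tm_nat; exact: hn.
Qed.

Local Notation gen := (span_class (span_id T)).

(** The span whose action recovers a from its product with the generator. *)
Definition yoneda_span X : span (prodg (prodg T X) T) X :=
  Span (gpair (gid _) (gfst T X)) (gsnd T X).

Lemma yoneda_gen X (a : S (prodg T X)) :
  mmap (m := N) (yoneda_span X) (span_pairing a gen) = a.
Proof.
rewrite /span_pairing span_classE burnside_unitE [LHS]shift_mapE.
rewrite /shift_act tR_mul !ts_RR.
pose D : gmap (prodg T X) (prodg T (prodg T X)) := gpair (gfst T X) (gid _).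
rewrite (@ts_RT _ _ _ _ _ _ _ (gfst T X) D); last first.
  split=> [[] //|y z _ /(congr1 snd)//|u [t [t' x]] /= [<- <-]].
  by exists (u, x).
rewrite tR_one frobenius_r mulr1 ts_RR ts_TT.
by rewrite (@ts_Tinv _ _ _ _ _ _ (gid _)) ?ts_RR ?ts_R1 // => -[].
Qed.
Section Extension.
Variables (P : mackey G) (ps : forall X Y, S X -> A (prodg T Y) -> P (prodg X Y)).
Hypothesis psP : is_pairing (M := mackey_of S) (N := Q) ps.

(** The map out of S(T x -) corresponding to the pairing ps. *)
Definition span_ext_fun X (a : S (prodg T X)) : P X :=
  mmap (yoneda_span X) (ps a gen).

Lemma span_ext_nat X Y (s : span X Y) (a : S (prodg T X)) :
  span_ext_fun (shift_map (M := mackey_of S) s a) = mmap s (span_ext_fun a).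
Proof.
case: s => K f h; have [_ _ nat] := psP; rewrite /span_ext_fun /shift_map.
rewrite -{1}[gen](@mmap_id _ Q) nat /yoneda_span.
pose f2 : gmap (prodg T K) (prodg (prodg T X) T) :=
  gpair (prod_gmap (gid T) f) (gfst T K).
transitivity (mmap (Span f2 (gcomp h (gsnd T K))) (ps a gen)).
  apply: (mmap_cart (a := gpair (gid _) (gfst T K)) (b := prod_gmap (gid T) h)) => //.
  split=> [[] //|[t k] [t' k'] /= [-> ->] //|[[t k] t'] [t2 y] /= [<- <- ->]].
  by exists (t, k).
apply/esym; apply: (mmap_cart (a := prod_gmap (gid T) f) (b := gsnd T K)) => //.
by split=> [[] //|[t k] [t' k'] /= [-> _] -> //|[t x] k /= ->]; exists (t, k).
Qed.

(** By naturality in the second variable it is enough to treat the generator,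
    the identity span of T. *)
Lemma span_ext_pairing X Y (a : S X) (b : A (prodg T Y)) :
  span_ext_fun (span_pairing a b) = ps a b.
Proof.
have [_ psr nat] := psP; have [_ pr pnat] := span_pairing_pairing.
move: b; apply: (completion_ext (span_class_completion T Y)) => [b b'|b b'|s].
- by rewrite /span_ext_fun pr; have [psl _ _] := psP; rewrite psl mmapD.
- exact: psr.
rewrite span_class_map -{1}[a](@mmap_id _ (mackey_of S)) [span_pairing _ _]pnat.
rewrite [LHS]span_ext_nat -{2}[a](@mmap_id _ (mackey_of S)) nat; congr (mmap _ _).
pose D : gmap (prodg X T) (prodg T (prodg X T)) := gpair (gsnd X T) (gid _).
have -> : span_pairing a gen = mmap (m := mackey_of S) (Span (gfst X T) D) a.
  rewrite /span_pairing span_classE burnside_unitE /shift_act.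
  rewrite (@ts_RT _ _ _ _ _ _ _ (gsnd X T) D); last first.
    split=> [[] //|y z _ /(congr1 snd)//|u [t [x t']] /= [<- <-]].
    by exists (x, u).
  by rewrite tR_one frobenius_r mulr1 ts_RR [RHS]ts_TR; congr (ts _ _); exact: ts_ext.
rewrite /span_ext_fun -{1}[gen](@mmap_id _ Q) nat.
pose f2 : gmap (prodg X T) (prodg X T) := gid _.
rewrite (mmap_cart (f2 := f2) (h2 := f2) (a := gpair (gid _) (gsnd X T)) (b := D)).
- by apply: mmap_self => //; exists id.
- split=> [[] //|[x t] [x' t'] /= [-> ->] //|[[x t] t'] [t2 [x2 t3]] /= [<- <- <- ->]].
  by exists (x, t).
- by case.
- by case.
Qed.
End Extension.

(** Yoneda: S(T x -) is the box product of S with A(T x -) = A^G(T, -). *)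
Lemma span_pairing_box :
  is_box (M := mackey_of S) (N := Q) (P := N) span_pairing.
Proof.
split=> [|P ps psP]; first exact: span_pairing_pairing.
have [psl _ _] := psP.
pose f : mackey_map N P := @MackeyMap _ N P (span_ext_fun ps)
  (fun X x y => etrans (congr1 _ (psl _ _ _ x y)) (mmapD _ _ _)) (span_ext_nat psP).
exists f; split=> [X Y a b|f' f'E X x]; first exact: (span_ext_pairing psP).
by rewrite -{1}[x]yoneda_gen mm_nat f'E.
Qed.

Lemma shift_module_free : is_free_on T N.
Proof.
exists Q, (@span_class T), span_pairing; split.
- exact: span_class_representable.
- exact: span_pairing_box.
by move=> X Y Z a b q; rewrite /span_pairing -[LHS]mactA.
Qed.
End FreeModule.
End Burnside.

(** * Monomials and polynomials over free bases *)

Section Monomials.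
Variables (G : finGroupType) (O : indexing_category G) (T : gset G).
Implicit Types X Y Z A B : gset G.

(** A polynomial T <- A -> B describes, at each point of B, a monomial in
    variables indexed by T; this is the exponent of the variable y at b. *)
Definition expo A B (f : gmap A T) (g : gmap A B) (b : B) (y : T) : nat :=
  #|[set a | (g a == b) && (f a == y)]|.

Lemma expoJ A B (f : gmap A T) (g : gmap A B) b y a :
  expo f g (b <* a) (y <* a) = expo f g b y.
Proof.
rewrite /expo -[RHS](card_imset _ (@gop_inj G A a)); apply: eq_card => z.
rewrite !inE; apply/andP/imsetP => [[/eqP e1 /eqP e2]|[z' + ->]].
  exists (z <* a^-1%g); last by rewrite gopVK.
  by rewrite inE !gmapJ e1 e2 !gopK !eqxx.
by rewrite inE !gmapJ => /andP[/eqP-> /eqP->].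
Qed.

Lemma expo_cart A B A' B' (f : gmap A T) (g : gmap A B) (u : gmap A' A)
    (g' : gmap A' B') (v : gmap B' B) (f' : gmap A' T) b y :
  is_cart u g' v g -> (forall a, f' a = f (u a)) ->
  expo f' g' b y = expo f g (v b) y.
Proof.
move=> [e I S] ef; rewrite /expo -(@card_in_imset _ _ u).
  apply: eq_card => a; rewrite !inE; apply/imsetP/andP => [[a' + ->]|[/eqP ga /eqP fa]].
    by rewrite inE ef e => /andP[/eqP-> /eqP->].
  have [a' [ua gb]] := S a b ga.
  by exists a' => //; rewrite inE ef ua gb fa !eqxx.
move=> a a'; rewrite !inE => /andP[/eqP e1 _] /andP[/eqP e2 _] ua.
by apply: I => //; rewrite e1 e2.
Qed.

(** Choose bijections over T between the fibres over one point of each orbit of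
    B, and translate them: freeness of B makes the translates well defined. *)
Lemma expo_iso A A' B (f : gmap A T) (g : gmap A B) (f' : gmap A' T)
    (g' : gmap A' B) (e : gmap B (orbitg 1%G)) :
  (forall b y, expo f g b y = expo f' g' b y) ->
  exists u : gmap A A', [/\ bijective u, forall a, f' (u a) = f a &
    forall a, g' (u a) = g a].
Proof.
move=> ee; have [r rJ] := orbit1_translation e.
have [[b y]|phi phiB phiE] :=
    @fibre_bijection A A' (B * T)%type (fun a => (g a, f a)) (fun a => (g' a, f' a)).
  by have := ee b y; rewrite /expo; congr (_ = _); apply: eq_card => a; rewrite !inE.
have phif a : f' (phi a) = f a by case: (phiE a).
have phig a : g' (phi a) = g a by case: (phiE a).
pose u0 a := phi (a <* (r (g a))^-1%g) <* r (g a).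
have u0J a h : u0 (a <* h) = u0 a <* h.
  rewrite /u0 gmapJ rJ -!gopM; congr (phi _ <* _).
  by rewrite invMg mulgA mulgV mul1g.
have u0f a : f' (u0 a) = f a by rewrite /u0 gmapJ phif gmapJ gopVK.
have u0g a : g' (u0 a) = g a by rewrite /u0 gmapJ phig gmapJ gopVK.
exists (GMap u0J); split=> //; apply: inj_card_bij => [a b /= eab|].
  have eg : g a = g b by rewrite -!u0g eab.
  move: eab; rewrite /u0 eg => /gop_inj/(bij_inj phiB)/gop_inj.
  exact.
by rewrite (bij_eq_card phiB).
Qed.

Section Degree.
Variable d : nat.

(** Exponents of a monomial of degree d are at most d; bounding them keeps the
    type of exponent families finite. *)
Definition fun_act (t : {ffun T -> 'I_d.+1}) (a : G) : {ffun T -> 'I_d.+1} :=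
  [ffun y => t (y <* a^-1%g)].
Lemma fun_act1 : fun_act^~ 1%g =1 id.
Proof. by move=> t; apply/ffunP => y; rewrite ffunE invg1 gop1. Qed.
Lemma fun_actM t : act_morph fun_act t.
Proof. by move=> a b; apply/ffunP => y; rewrite !ffunE invMg gopM. Qed.
Definition fung : gset G := GSet (TotalAction fun_act1 fun_actM).

Definition mon_pred (t : fung) := (\sum_y (t y : nat) == d)%N.
Lemma mon_predJ t a : mon_pred t -> mon_pred (t <* a).
Proof.
rewrite /mon_pred; suff -> : (\sum_y ((t <* a) y : nat) = \sum_y (t y : nat))%N by [].
rewrite (reindex_inj (@gop_inj G T a)) /=.
by apply: eq_bigr => y _; rewrite ffunE gopK.
Qed.

Definition mon : gset G := Defs.subg mon_predJ.
Definition mon_expo (t : mon) (y : T) : nat := (val t : fung) y.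

Lemma mon_expoJ t y a : mon_expo (t <* a) (y <* a) = mon_expo t y.
Proof. by rewrite /mon_expo /= ffunE gopK. Qed.

Lemma mon_degree t : (\sum_y mon_expo t y = d)%N.
Proof. by apply/eqP; exact: (valP t). Qed.

Lemma mon_ext (t t' : mon) : mon_expo t =1 mon_expo t' -> t = t'.
Proof. by move=> e; apply/val_inj/ffunP => y; apply/val_inj/e. Qed.

Lemma mon_ex (m : T -> nat) : (\sum_y m y = d)%N -> exists t, mon_expo t =1 m.
Proof.
move=> md; have le y : (m y < d.+1)%N by rewrite ltnS -md (bigD1 y) //= leq_addr.
pose t : fung := [ffun y => Ordinal (le y)].
have tP : mon_pred t.
  by rewrite /mon_pred -[X in _ == X]md; apply/eqP/eq_bigr => y _; rewrite ffunE.
by exists (exist _ t tP) => y; rewrite /mon_expo /= ffunE.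
Qed.

Definition triv_act (k : 'I_d) (_ : G) := k.
Definition trivg : gset G :=
  GSet (TotalAction (to := triv_act) (fun _ => erefl) (fun _ _ _ => erefl)).

(** A monomial t with exponents m_y is realized by the points (y, t, k) for
    k < m_y.  G acts trivially on the index k, which makes this a family of
    G-sets over the whole of mon. *)
Definition umon_pred (z : prodg (prodg T mon) trivg) :=
  ((z.2 : 'I_d) < mon_expo z.1.2 z.1.1)%N.
Lemma umon_predJ z a : umon_pred z -> umon_pred (z <* a).
Proof. by rewrite /umon_pred /= mon_expoJ. Qed.
Definition umon : gset G := Defs.subg umon_predJ.
Definition umon_var : gmap umon T :=
  gcomp (gfst T mon) (gcomp (gfst _ trivg) (subg_val umon_predJ)).
Definition umon_base : gmap umon mon :=
  gcomp (gsnd T mon) (gcomp (gfst _ trivg) (subg_val umon_predJ)).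

Lemma expo_umon t y : expo umon_var umon_base t y = mon_expo t y.
Proof.
have leT : (mon_expo t y <= d)%N by rewrite -ltnS; exact: ltn_ord.
rewrite /expo -(@card_in_imset _ _ (fun z : umon => (val z).2 : 'I_d)); last first.
  move=> [[[y1 t1] k1] h1] [[[y2 t2] k2] h2]; rewrite !inE /=.
  move=> /andP[/eqP et1 /eqP ey1] /andP[/eqP et2 /eqP ey2] ek.
  by apply: val_inj; rewrite /= et1 et2 ey1 ey2 ek.
transitivity #|[set k : 'I_d | (k < mon_expo t y)%N]|.
  apply: eq_card => k; rewrite inE; apply/imsetP/idP => [[[[[y1 t1] k1] h1]]|kt].
    by rewrite inE /= => /andP[/eqP<- /eqP<-] ->.
  by exists (exist _ ((y, t), k) kt) => //; rewrite inE /= !eqxx.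
rewrite -sum1_card (eq_bigl (fun k : 'I_d => (k < mon_expo t y)%N)).
  by rewrite -(big_ord_widen d (fun=> 1%N)) // sum1_card card_ord.
by move=> k; rewrite inE.
Qed.

(** The tautological family need not lie in O, but it does after pulling back
    to a free G-set. *)
Lemma free_umonO : ic_mem O (prod_gmap (gid (orbitg 1%G)) umon_base).
Proof.
apply: ic_stabilizer_preserving => -[C z] a [/orbit1_free-> _].
by rewrite gop1.
Qed.

Definition free_umon : bispan O T (prodg (orbitg 1%G) mon) :=
  Bispan (gcomp umon_var (gsnd _ _)) free_umonO (gid _).

Lemma expo_free_umon z y : expo (bf free_umon) (bg free_umon) z y = mon_expo z.2 y.
Proof.
rewrite -expo_umon; apply: (@expo_cart _ _ _ _ _ _ (gsnd _ _) _ (gsnd _ _)) => //.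
by split=> [//|[? ?] [? ?] /= -> [->]//|u [C t] /= <-]; exists (C, u).
Qed.
End Degree.

(** * Strata of a polynomial by degree *)

Section Strata.
Variables (X : gset G) (p : bispan O T X) (d : nat).

Definition stratum_pred (z : prodg (mon d) (bB p)) :=
  [forall y, mon_expo z.1 y == expo (bf p) (bg p) z.2 y].
Lemma stratum_predJ z a : stratum_pred z -> stratum_pred (z <* a).
Proof.
move=> /forallP h; apply/forallP => y; rewrite -[y](gopVK _ a) /=.
by rewrite mon_expoJ expoJ; exact: h.
Qed.

(** The points where p has degree d.  Keeping the monomial as part of the datum
    makes the classifying map to mon d a projection; it is determined by the
    point (stratum_inj). *)
Definition stratum : gset G := Defs.subg stratum_predJ.
Definition stratum_mon : gmap stratum (mon d) :=
  gcomp (gfst _ _) (subg_val stratum_predJ).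
Definition stratum_incl : gmap stratum (bB p) :=
  gcomp (gsnd _ _) (subg_val stratum_predJ).
Definition stratum_span : span (mon d) X :=
  Span stratum_mon (gcomp (bh p) stratum_incl).

Lemma stratumP z y :
  mon_expo (stratum_mon z) y = expo (bf p) (bg p) (stratum_incl z) y.
Proof. by case: z => [[t b] h] /=; apply/eqP/(forallP h). Qed.

Lemma stratum_inj : injective stratum_incl.
Proof.
move=> z w e; apply/val_inj/injective_projections => //.
by apply: mon_ext => y; rewrite [LHS]stratumP [RHS]stratumP e.
Qed.

Lemma stratum_ex (t : mon d) b :
  (forall y, mon_expo t y = expo (bf p) (bg p) b y) ->
  exists z, stratum_mon z = t /\ stratum_incl z = b.
Proof.
move=> e; have h : stratum_pred (t, b) by apply/forallP => y; apply/eqP/e.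
by exists (exist _ (t, b) h).
Qed.
End Strata.
Arguments stratum_mon {X p d}.
Arguments stratum_incl {X p d}.

Definition degree X (p : bispan O T X) (b : bB p) : nat :=
  \sum_y expo (bf p) (bg p) b y.

Lemma stratum_degree X (p : bispan O T X) d (z : stratum p d) :
  degree (stratum_incl z) = d.
Proof.
rewrite -[RHS](mon_degree (stratum_mon z)); apply: eq_bigr => y _.
by rewrite stratumP.
Qed.

Lemma stratum_onto X (p : bispan O T X) (b : bB p) :
  exists z : stratum p (degree b), stratum_incl z = b.
Proof.
have [t tE] := mon_ex (erefl (degree b)).
by have [z [_ zb]] := stratum_ex tE; exists z.
Qed.

(** Isomorphism invariance, additivity and compatibility with composition of
    the strata all follow from the fact that they commute with pulling back the
    polynomial along a map of bases. *)
Lemma stratum_cart X Y (p : bispan O T X) (q : bispan O T Y) d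
    (u : gmap (bA q) (bA p)) (v : gmap (bB q) (bB p)) :
  is_cart u (bg q) v (bg p) -> (forall a, bf q a = bf p (u a)) ->
  exists w : gmap (stratum q d) (stratum p d),
    (forall z, stratum_mon (w z) = stratum_mon z) /\
    is_cart w stratum_incl v stratum_incl.
Proof.
move=> c ef.
have h (z : stratum q d) :
    stratum_pred (gpair stratum_mon (gcomp v stratum_incl) z).
  apply/forallP => y; apply/eqP; rewrite /= [LHS]stratumP.
  exact: (expo_cart _ _ c ef).
exists (sub_lift (@stratum_predJ _ p d) h); split=> //; split=> // [z w _|z b e].
  exact: stratum_inj.
have [|z' [zm zb]] := @stratum_ex _ q d (stratum_mon z) b.
  by move=> y; rewrite stratumP e; apply/esym; exact: (expo_cart _ _ c ef).
by exists z'; split=> //; apply: stratum_inj; rewrite e -zb.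
Qed.
End Monomials.
Arguments stratum_mon {G O T X p d} : simpl never.
Arguments stratum_incl {G O T X p d} : simpl never.
Lemma cart_bij (G : finGroupType) (X Y Z W : gset G) (a : gmap X Z) (b : gmap X Y)
    (g : gmap Y W) (h : gmap Z W) :
  is_cart a b g h -> bijective g -> bijective a.
Proof.
move=> [e I S] gB; apply: inj_surj_bij => [x y exy|z].
  by apply: I => //; apply: (bij_inj gB); rewrite -!e exy.
have [y yz] := bij_surj gB (h z).
by have [x [<- _]] := S z y (esym yz); exists x.
Qed.

(** * The degree d part of the free Tambara functor *)

Section FreeTambara.
Variables (G : finGroupType) (O : indexing_category G) (T : gset G).
Variables (F : tambara O) (ioF : forall X : gset G, bispan O T X -> F X).
Hypothesis hF : is_free_tambara ioF.
Implicit Types X Y Z : gset G.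

(** Yoneda: a polynomial is its own value at the identity of T. *)
Lemma ioF_tmap X (p : bispan O T X) : ioF p = tmap p (ioF (bid O T)).
Proof.
have [/(_ X)[ie _ _] nat] := hF.
rewrite -nat -(ie _ _ (bcomp_NR (gid T) (ic_id O T) p)); apply: ie.
have e (a : bA p) : gid T (bf p a) = bf p (gid (bA p) a) by [].
exists (pb_lift (f := gid T) (g := bf p) e), (gid (bB p)); split=> //; last exact: gid_bij.
exists pb2 => // z; apply: pb_inj => //; exact/esym/(pbE z).
Qed.

Section Psi.
Variables (A : tambara O) (ioA : forall X : gset G, gset_over X -> A X).
Hypothesis hA : is_burnside ioA.
Variable d : nat.
Local Notation Q := (shift (mon T d) (mackey_of A)).

Definition stratum_class X (p : bispan O T X) : Q X :=
  span_class ioA (stratum_span p d).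

Lemma stratum_class_iso X (p q : bispan O T X) :
  bispan_iso p q -> stratum_class p = stratum_class q.
Proof.
case=> u [v [uB vB ef eg eh]].
have c : is_cart u (bg p) v (bg q).
  split=> // [x y e _|a b e]; first exact: (bij_inj uB).
  have [x xa] := bij_surj uB a; exists x; split=> //.
  by apply: (bij_inj vB); rewrite -eg xa e.
have [w [wm cw]] := stratum_cart d c (fun a => esym (ef a)).
have [/(_ X)[ie _ _] _] := span_class_representable hA (mon T d); apply: ie.
exists (w : gmap (sS (stratum_span p d)) (sS (stratum_span q d))).
split=> [|//|z]; first exact: (cart_bij cw).
by have [e _ _] := cw; rewrite -[LHS]/(bh q (stratum_incl (w z))) e eh.
Qed.

Lemma stratum_class_add X (p q : bispan O T X) :
  stratum_class (badd p q) = stratum_class p + stratum_class q.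
Proof.
have cl : is_cart (ginl (bA p) (bA q)) (bg p) (ginl (bB p) (bB q)) (bg (badd p q)).
  exact: sum_fold_cartl.
have cr : is_cart (ginr (bA p) (bA q)) (bg q) (ginr (bB p) (bB q)) (bg (badd p q)).
  exact: sum_fold_cartr.
have [wl [ml [el Il Sl]]] := stratum_cart (p := badd p q) (q := p) d cl (fun=> erefl).
have [wr [mr [er Ir Sr]]] := stratum_cart (p := badd p q) (q := q) d cr (fun=> erefl).
have [/(_ X)[ie ia _] _] := span_class_representable hA (mon T d).
rewrite /stratum_class -ia; apply/esym/ie.
exists (gcopair wl wr : gmap (sS (span_add (stratum_span p d) (stratum_span q d)))
  (sS (stratum_span (badd p q) d))); split.
- apply: inj_surj_bij => [[z|z] [z'|z'] /= e|z].
  + by congr inl; apply: stratum_inj; have := el z; rewrite e el => -[].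
  + by have := el z; rewrite e er.
  + by have := er z; rewrite e el.
  + by congr inr; apply: stratum_inj; have := er z; rewrite e er => -[].
  case ez: (stratum_incl z : (bB p + bB q)%type) => [b|b].
    by have [z' [<- _]] := Sl z b ez; exists (inl z').
  by have [z' [<- _]] := Sr z b ez; exists (inr z').
- by case=> z; [exact: ml|exact: mr].
- case=> z; first by rewrite -[LHS]/(gcopair (bh p) (bh q) (stratum_incl (wl z))) el.
  by rewrite -[LHS]/(gcopair (bh p) (bh q) (stratum_incl (wr z))) er.
Qed.

Lemma stratum_class_span X Y (p : bispan O T X) (s : span X Y) :
  stratum_class (bcomp p (bspan O s)) = mmap s (stratum_class p).
Proof.
rewrite -(stratum_class_iso (bcomp_span p s)); set r := Bispan _ _ _.
have [/(_ Y)[ie _ _] nat] := span_class_representable hA (mon T d).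
rewrite /stratum_class -nat; apply: ie.
have c : is_cart (pb1 : gmap (bA r) (bA p)) (bg r) (pb1 : gmap (bB r) (bB p)) (bg p).
  split=> [z|z z'|a b e]; [exact: pbE|exact: pb_inj|by exists (pb_elt e)].
have [w [wm [ew Iw Sw]]] := stratum_cart d c (fun=> erefl).
have e (z : stratum r d) :
    gcomp (bh p) stratum_incl (w z) = sf s (gcomp pb2 (stratum_incl : gmap _ (bB r)) z).
  rewrite -[LHS]/(bh p (stratum_incl (w z))) ew; exact: pbE.
exists (pb_lift e : gmap (sS (stratum_span r d)) (sS (span_comp (stratum_span p d) s))).
split=> //.
apply: inj_surj_bij => [z z' ez|z].
  apply: Iw; first exact: (congr1 pb1 ez).
  apply: pb_inj; last exact: (congr1 pb2 ez).
  have ewz : w z = w z' := congr1 pb1 ez.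
  by have := congr1 stratum_incl ewz; rewrite !ew.
have ez : bh p (stratum_incl (pb1 z)) = sf s (pb2 z) by exact: (pbE z).
have [z' [e1 e2]] := Sw (pb1 z) (pb_elt ez) erefl.
exists z'; apply: pb_inj => //.
by rewrite -[LHS]/(pb2 (stratum_incl z')) e2.
Qed.

(** Spans act on the base of a polynomial and leave the monomials at its points
    unchanged, so recording the monomials of degree d is a map of Mackey
    functors from F to A^G(mon T d, -). *)
Lemma stratum_map_ex : exists psi : mackey_map (mackey_of F) Q,
  forall X (p : bispan O T X), mm psi (ioF p) = stratum_class p.
Proof.
have [hc nat] := hF.
have ex X : exists2 f : F X -> Q X, (forall x y, f (x + y) = f x + f y) &
    forall p, f (ioF p) = stratum_class p.
  have [_ _ iU] := hc X.
  have [f [fD fE _]] := iU _ _ (@stratum_class_iso X) (@stratum_class_add X).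
  by exists f.
pose f X := s2val (cid2 (ex X)).
have fD X : {morph @f X : x y / x + y} by rewrite /f; case: cid2.
have fE X p : f X (ioF p) = stratum_class p by rewrite /f; case: cid2.
have fnat X Y (s : span X Y) (x : F X) : f Y (ts s x) = mmap s (f X x).
  move: x; apply: (completion_ext (hc X)) => [x y|x y|p].
  - by rewrite ts_add fD.
  - by rewrite fD mmapD.
  by rewrite /ts -nat !fE; exact: stratum_class_span.
by exists (@MackeyMap _ (mackey_of F) Q f fD fnat).
Qed.
End Psi.
End FreeTambara.

(** * Restrictions of polynomials to free G-sets *)

Section FreeRestriction.
Variables (G : finGroupType) (O : indexing_category G) (R : tambara O) (T : gset G).

(** Restriction pulls polynomials back, and over the free G-set K polynomials
    with the same monomials are isomorphic. *)
Lemma restrict_free_eq (A B A' B' K : gset G) (f : gmap A T) (g : gmap A B)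
    (gO : ic_mem O g) (f' : gmap A' T) (g' : gmap A' B') (gO' : ic_mem O g')
    (v : gmap K B) (v' : gmap K B') (e : gmap K (orbitg 1%G)) (x : R T) :
  (forall k y, expo f g (v k) y = expo f' g' (v' k) y) ->
  tR v (tmap (Bispan f gO (gid B)) x) = tR v' (tmap (Bispan f' gO' (gid B')) x).
Proof.
have pull A1 B1 (f1 : gmap A1 T) (g1 : gmap A1 B1) (gO1 : ic_mem O g1) (w : gmap K B1) :
    tR w (tmap (Bispan f1 gO1 (gid B1)) x) =
    tmap (Bispan (gcomp f1 pb1) (ic_pb2 w gO1) (gid K)) x.
  apply: (@tmap_span _ _ _ _ _ _ (Bispan f1 gO1 (gid B1)) (spanR w)
    (Bispan (gcomp f1 pb1) (ic_pb2 w gO1) (gid K)) pb1 w (gid K)) => //.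
    by split=> // u k /= ->; exists k.
  by split=> [z|z z'|a b eab]; [exact: pbE|exact: pb_inj|exists (pb_elt eab)].
move=> ee; rewrite !pull; apply: tmap_iso.
have cart A1 B1 (g1 : gmap A1 B1) (w : gmap K B1) :
    is_cart (pb1 (f := g1) (g := w)) pb2 w g1.
  by split=> [z|z z'|a b eab]; [exact: pbE|exact: pb_inj|exists (pb_elt eab)].
have [k y|u [uB uf ug]] := @expo_iso _ _ _ _ _ (gcomp f (pb1 (f := g) (g := v))) pb2
    (gcomp f' (pb1 (f := g') (g := v'))) pb2 e.
  rewrite (expo_cart (f := f) k y (cart _ _ g v)) //.
  by rewrite (expo_cart (f := f') k y (cart _ _ g' v')).
by exists u, (gid K); split=> //; exact: gid_bij.
Qed.
End FreeRestriction.

(** * Module maps out of S(T x -) *)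

Section Evaluation.
Variables (G : finGroupType) (O : indexing_category G) (S B : tambara O).
Variables (i : tambara_map S B) (T : gset G) (m : B T).
Implicit Types X Y Z : gset G.

(** The map of S-modules out of S(T x -) that sends the generator to m. *)
Definition eval_fun X (a : S (prodg T X)) : B X :=
  tT (gsnd T X) (tm i a * tR (gfst T X) m).

Lemma eval_funD X : {morph @eval_fun X : a b / a + b}.
Proof. by move=> a b; rewrite /eval_fun tm_add mulrDl tT_add. Qed.

Lemma eval_nat X Y (s : span X Y) (a : shift_val T (mackey_of S) X) :
  eval_fun (shift_map s a) = ts s (eval_fun a).
Proof.
case: s => K f h; rewrite shift_mapE /eval_fun ts_TR.
rewrite (@ts_RT _ _ _ _ _ _ _ (prod_gmap (gid T) f) (gsnd T K)); last first.
  by split=> [//|[? ?] [? ?] /= [-> _] -> //|[t x] k /= ->]; exists (t, k).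
rewrite tR_mul ts_TT [tm i _]tm_nat -/(ts _ _) frobenius ts_TT.
rewrite [tm i _]tm_nat -/(ts _ _) !ts_RR.
by apply: ts_T_ext => //; congr (_ * _); exact: ts_ext.
Qed.

Lemma eval_act X Y (a : S X) (b : S (prodg T Y)) :
  eval_fun (shift_act a b) = alg_act i a (eval_fun b).
Proof.
rewrite /eval_fun /alg_act /ext_mul.
rewrite (@ts_RT _ _ _ _ _ _ _ (shift_pr2 T X Y) (gsnd T (prodg X Y))); last first.
  split=> [//|[t [x y]] [t' [x' y']] /= [-> ->] [->] //|[t y] [x y'] /= ->].
  by exists (t, (x, y')).
rewrite frobenius_r /shift_act tR_mul tm_mul !ts_RR -mulrA.
rewrite ![tm i (ts _ _)]tm_nat -!/(ts _ _).
by apply: ts_T_ext => //; congr (_ * (_ * _)); exact: ts_ext.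
Qed.

Lemma eval_span X (s : span T X) : eval_fun (tT (gpair (sf s) (sh s)) 1) = ts s m.
Proof.
rewrite /eval_fun [tm i _]tm_nat -/(ts _ _) tm_one frobenius mul1r ts_RR ts_TT.
by case: s => K f h; rewrite [RHS]ts_TR; apply: ts_T_ext => //; exact: ts_ext.
Qed.

Lemma eval_yoneda X (a : S (prodg T X)) :
  eval_fun a = ts (yoneda_span T X) (alg_act i a m).
Proof.
rewrite /eval_fun /yoneda_span ts_TR /alg_act /ext_mul tR_mul !ts_RR.
apply: ts_T_ext => //; congr (_ * _); last exact: ts_ext.
by rewrite ts_R1 // => -[].
Qed.

Definition eval_map : mackey_map (shift_module S T) (module_of i) :=
  @MackeyMap _ (shift_module S T) (module_of i) eval_fun eval_funD eval_nat.

Lemma eval_module_map : is_module_map (M := shift_module S T) (N := module_of i) eval_map.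
Proof. by move=> X Y a b; exact: eval_act. Qed.
End Evaluation.

(** * The decomposition of B *)

Section Decomposition.
Variables (G : finGroupType) (O : indexing_category G) (T : gset G).
Variables (A : tambara O) (ioA : forall X : gset G, gset_over X -> A X).
Hypothesis hA : is_burnside ioA.
Variables (S : tambara O) (l : tambara_map A S) (r : S (pointg G)).
Hypothesis hr : tT (to_point (orbitg (G := G) 1%G)) 1 * r = 1.
Variables (F : tambara O) (ioF : forall X : gset G, bispan O T X -> F X).
Hypothesis hF : is_free_tambara ioF.
Variables (B : tambara O) (i : tambara_map S B) (j : tambara_map F B).
Hypothesis hB : is_tambara_box i j.
Implicit Types X Y Z : gset G.

Local Notation E := (orbitg (G := G) 1%G).
Local Notation N d := (shift_module S (mon T d)).
Local Notation u := (tm j (ioF (bid O T))).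

Lemma j_polynomial X (p : bispan O T X) : tm j (ioF p) = tmap p u.
Proof. by rewrite (ioF_tmap hF) tm_nat. Qed.

(** Transfer and restriction along E x mon d -> mon d compose to multiplication
    by [E], whence the factor r = [E]^-1. *)
Definition mon_elt d : B (mon T d) :=
  tT (gsnd E (mon T d)) (tmap (free_umon O T d) u) * tR (to_point _) (tm i r).

Lemma orbit_unit_image : tT (to_point E) 1 * tm i r = 1.
Proof. by rewrite -(tm_one i (pointg G)) -hr tm_mul [tm i (ts _ _)]tm_nat tm_one. Qed.

(** Over E x K, the restrictions of the tautological polynomial along c and of
    the polynomial classified by c have the same monomials, so they agree.
    Transferring back to K multiplies the latter by [E], which r cancels. *)
Lemma mon_elt_restrict d (A0 B0 K : gset G) (f : gmap A0 T) (g : gmap A0 B0)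
    (gO : ic_mem O g) (c : gmap K (mon T d)) (v : gmap K B0) :
  (forall k y, mon_expo (c k) y = expo f g (v k) y) ->
  tR c (mon_elt d) = tR v (tmap (Bispan f gO (gid B0)) u).
Proof.
move=> ce; rewrite /mon_elt tR_mul ts_RR.
rewrite (@ts_RT _ _ _ _ _ _ _ (prod_gmap (gid E) c) (gsnd E K)); last first.
  by split=> [//|[? ?] [? ?] /= [-> _] -> //|[C t] k /= ->]; exists (C, k).
rewrite (restrict_free_eq (free_umonO O T d) gO (f' := f) (v' := gcomp v (gsnd E K))
  (gfst E K)); last first.
  by move=> z y; rewrite -ce expo_free_umon.
rewrite -[RHS](@transfer_restrict _ _ _ E _ _ _ orbit_unit_image) ts_RR.
by congr (_ * _); exact: ts_ext.
Qed.

Definition strata_map d : mackey_map (mackey_of F) (shift (mon T d) (mackey_of A)) :=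
  projT1 (cid (stratum_map_ex hF hA d)).

Lemma strata_mapE d X (p : bispan O T X) :
  mm (strata_map d) (ioF p) = stratum_class ioA d p.
Proof. by rewrite /strata_map; case: cid. Qed.

Lemma coef_ex d : exists f : mackey_map (mackey_of B) (N d),
  forall X Y (a : S X) (b : F Y),
    mm f (ext_mul (tm i a) (tm j b)) = span_pairing l a (mm (strata_map d) b).
Proof.
have [hl hs hn] := span_pairing_pairing l (mon T d).
have [_ /(_ (N d) (fun X Y a b => span_pairing l a (mm (strata_map d) b)))] := hB.
case=> [|f [fE _]]; last by exists f.
split=> [X Y b a a'|X Y a b b'|X X' Y Y' s t a b].
- exact: hl.
- by rewrite mmD; exact: hs.
- by rewrite mm_nat; exact: hn.
Qed.

(** The coefficients of the monomials of degree d, extended S-linearly from F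
    to B. *)
Definition coef d : mackey_map (mackey_of B) (N d) := projT1 (cid (coef_ex d)).

Lemma coefE d X Y (a : S X) (b : F Y) :
  mm (coef d) (ext_mul (tm i a) (tm j b)) = span_pairing l a (mm (strata_map d) b).
Proof. by move: X Y a b; rewrite /coef; case: cid. Qed.

Lemma coef_act d X Y (a : S X) (x : B Y) :
  mm (coef d) (alg_act i a x) = shift_act a (mm (coef d) x).
Proof.
have [pl pr pn] := mact_pairing (N d).
have [bl br bn] := mact_pairing (module_of i).
(* Both sides are compatible with spans in x, so x may be taken to be a product
   of elements of S and F. *)
pose P Y (x : B Y) := forall X (a : S X),
  mm (coef d) (alg_act i a x) = shift_act a (mm (coef d) x).
have P0 Z : P Z 0.
  move=> Z' b; rewrite (mm0 (coef d)).
  by rewrite [alg_act _ _ _](additive0 (br _ _ b)) mm0 [RHS](additive0 (pr _ _ b)).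
have PB Z x1 x2 : P Z x1 -> P Z x2 -> P Z (x1 - x2).
  move=> h1 h2 Z' b; rewrite [alg_act _ _ _](additiveB (br _ _ b)) !mmB h1 h2.
  by rewrite [RHS](additiveB (pr _ _ b)).
have Pm Z Z' (s : span Z Z') x1 : P Z x1 -> P Z' (ts s x1).
  move=> h W b.
  have e1 := bn _ _ _ _ (span_id W) s b x1; have e2 := pn _ _ _ _ (span_id W) s b.
  rewrite (@mmap_id _ (green_of S)) in e1 e2.
  rewrite [alg_act _ _ _]e1 (mm_nat (coef d) s) [RHS]e2.
  by rewrite (mm_nat (coef d) (span_prod (span_id W) s)); congr (mmap _ _); exact: h.
pose PS : submackey (mackey_of B) := @Submackey _ (mackey_of B)
  (fun Z => @Subgroup (mackey_of B Z) (P Z) (P0 Z) (@PB Z)) Pm.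
suff base Z Z' (b : S Z) (c : F Z') : P _ (ext_mul (tm i b) (tm j c)).
  exact: (box_ind hB (P := PS) base).
move=> W a0.
rewrite [ext_mul _ _]/(alg_act i b (tm j c)) -alg_actA.
rewrite [LHS](mm_nat (coef d) (spanT (gassoc W Z Z'))).
rewrite /alg_act !coefE /span_pairing; exact: shift_actA.
Qed.

Lemma coef_j d Y (b : F Y) : mm (coef d) (tm j b) = tm l (mm (strata_map d) b).
Proof.
rewrite -{1}[tm j b]ext_mul1 -(tm_one i (pointg G)).
rewrite (mm_nat (coef d) (spanT (gsnd (pointg G) Y))) coefE.
exact: shift_act1.
Qed.

Lemma coef_scale d X (x : B X) :
  mm (coef d) (x * tR (to_point X) (tm i r)) =
  (mm (coef d) x : S (prodg (mon T d) X)) * tR (to_point _) r.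
Proof.
have -> : x * tR (to_point X) (tm i r) =
    tR (gpair (to_point X) (gid X)) (alg_act i r x).
  by rewrite /alg_act /ext_mul tR_mul !ts_RR mulrC [tR _ x]ts_R1 //; congr (_ * _);
    exact: ts_ext.
rewrite (mm_nat (coef d) (spanR _)) coef_act [LHS]shift_mapR.
rewrite /shift_act tR_mul !ts_RR mulrC [X in X * _]ts_R1; last by case.
by congr (_ * _); exact: ts_ext.
Qed.

Local Notation fu d := (free_umon O T d).

Lemma coef_mon_eltE d e :
  mm (coef e) (mon_elt d) =
  tT (gpair stratum_mon (gcomp (gsnd E (mon T d)) (stratum_incl (p := fu d))) :
        gmap (stratum (fu d) e) _) 1 * tR (to_point _) r.
Proof.
rewrite /mon_elt coef_scale (mm_nat (coef e) (spanT _)) -j_polynomial coef_j strata_mapE.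
rewrite /stratum_class (span_classE hA) burnside_unitE [mmap _ _]shift_mapT ts_TT.
by congr (_ * _); exact: ts_T_ext.
Qed.

Lemma fu_degree d e (z : stratum (fu d) e) : e = d.
Proof.
rewrite -(stratum_degree z) -[RHS](mon_degree (stratum_incl z).2).
by apply: eq_bigr => y _; exact: expo_free_umon.
Qed.

Lemma coef_mon_elt_neq d e : e != d -> mm (coef e) (mon_elt d) = 0.
Proof.
move=> ed; rewrite coef_mon_eltE [tT _ _](@mmap_empty _ (mackey_of S)) ?mul0r //.
by move=> z; case/eqP: ed; exact: fu_degree z.
Qed.

(** The tautological polynomial carries each monomial t over the points (e, t),
    so its image is a transfer from E x mon d along the projection followed by
    the diagonal; the factor [E] that this produces cancels r. *)
Lemma coef_mon_elt d :
  mm (coef d) (mon_elt d) = tm l (span_class ioA (span_id (mon T d))).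
Proof.
rewrite coef_mon_eltE (span_classE hA) burnside_unitE.
have inclB : bijective (stratum_incl : gmap (stratum (fu d) d) _).
  apply: inj_surj_bij => [|z]; first exact: stratum_inj.
  have [w [_ <-]] : exists w : stratum (fu d) d, stratum_mon w = z.2 /\ stratum_incl w = z.
    by apply: stratum_ex => y; rewrite expo_free_umon.
  by exists w.
have [k [kK incK]] := bij_gmap_inv inclB.
rewrite (@ts_T_ext _ _ _ _ _ _ (gcomp (gpair (gid _) (gid _))
  (gcomp (gsnd E _) (stratum_incl (p := fu d)))) _ 1) //; last first.
  move=> z; congr pair; apply: mon_ext => y.
  by rewrite [LHS]stratumP expo_free_umon.
rewrite -2!ts_TT (ts_Tinv _ kK incK) tR_one frobenius.
apply: ts_T_ext => //; rewrite ts_RR -[RHS](transfer_restrict _ hr) tR_one.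
by congr (_ * _); exact: ts_ext.
Qed.

Lemma coef_eval d X (a : S (prodg (mon T d) X)) :
  mm (coef d) (eval_fun i (mon_elt d) a) = a.
Proof.
rewrite eval_yoneda (mm_nat (coef d) (yoneda_span _ X)) coef_act coef_mon_elt.
exact: (yoneda_gen hA l a).
Qed.

Lemma coef_eval_neq d e X (a : S (prodg (mon T d) X)) : e != d ->
  mm (coef e) (eval_fun i (mon_elt d) a) = 0.
Proof.
move=> ed; rewrite eval_yoneda (mm_nat (coef e) (yoneda_span _ X)) coef_act.
rewrite coef_mon_elt_neq //; have [_ pr _] := mact_pairing (N e).
by rewrite [shift_act _ _](additive0 (pr _ _ a)) mmap0.
Qed.

(** A value of a polynomial splits along the partition of its base by degree,
    and on each stratum it is a restriction of the monomial element. *)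
Lemma tmap_strata X (p : bispan O T X) n : (forall b : bB p, degree b < n)%N ->
  tmap p u = \sum_(d < n) ts (stratum_span p d) (mon_elt d).
Proof.
move=> pn; pose p0 := Bispan (bf p) (bgO p) (gid (bB p)).
have -> : tmap p u = tT (bh p) (tmap p0 u).
  apply/esym; apply: (@tmap_span _ _ _ _ _ _ p0 (spanT (bh p)) p
    (gid _) (gid _) (gid _)) => //.
    by split=> // b b' e; exists b.
  by split=> // a b e; exists a.
rewrite [X in tT _ X](@mmap_partition _ (mackey_of B) _ (@degree _ _ _ _ p) n
  (fun d => stratum p d) (fun d => stratum_incl) _ pn); first last.
- by move=> b; exact: stratum_onto.
- by move=> d z; exact: stratum_degree.
- by move=> d; exact: stratum_inj.
rewrite (big_morph _ (@tT_add _ _ B _ _ (bh p)) (@ts0 _ _ B _ _ (spanT (bh p)))).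
apply: eq_bigr => d _; rewrite [mmap _ _]ts_TR ts_TT [RHS]ts_TR; apply: ts_T_ext => //.
apply/esym; apply: mon_elt_restrict => z y; exact: stratumP.
Qed.

(** Both the finiteness of the sum and its value are inherited along sums and
    spans and under the action of S, which reduces the claim to polynomials;
    these have finitely many points and so a bounded degree. *)
Lemma decomposition X (x : B X) : exists n, forall m, (n <= m)%N ->
  x = \sum_(d < m) eval_fun i (mon_elt d) (mm (coef d) x) /\ mm (coef m) x = 0.
Proof.
pose P Y (x : B Y) := exists n, forall m, (n <= m)%N ->
  x = \sum_(d < m) eval_fun i (mon_elt d) (mm (coef d) x) /\ mm (coef m) x = 0.
have P0 Y : P Y 0.
  exists 0%N => m _; rewrite mm0; split=> //.
  rewrite big1 // => d _; rewrite mm0.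
  exact: (additive0 (@eval_funD _ _ _ _ _ _ _ _)).
have PB Y x1 x2 : P Y x1 -> P Y x2 -> P Y (x1 - x2).
  move=> [n1 h1] [n2 h2]; exists (maxn n1 n2) => m; rewrite geq_max => /andP[l1 l2].
  have [e1 z1] := h1 m l1; have [e2 z2] := h2 m l2.
  split; last by rewrite mmB z1 z2 subr0.
  rewrite {1}e1 {1}e2 -sumrB; apply: eq_bigr => d _; rewrite mmB.
  exact/esym/(additiveB (@eval_funD _ _ _ _ _ _ _ _)).
have Pm Y Z (s : span Y Z) x1 : P Y x1 -> P Z (ts s x1).
  move=> [n h]; exists n => m nm; have [e1 z1] := h m nm.
  split; last by rewrite (mm_nat (coef m) s) z1 mmap0.
  rewrite {1}e1 (big_morph _ (@ts_add _ _ B _ _ s) (@ts0 _ _ B _ _ s)).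
  by apply: eq_bigr => d _; rewrite (mm_nat (coef d) s) -eval_nat.
have Pa Y Z (a : S Y) (x1 : B Z) : P Z x1 -> P _ (alg_act i a x1).
  move=> [n h]; exists n => m nm; have [e1 z1] := h m nm.
  have [_ pr _] := mact_pairing (N m); have [_ br _] := mact_pairing (module_of i).
  split; last by rewrite coef_act z1; exact: (additive0 (pr _ _ a)).
  rewrite {1}e1 [LHS](big_morph _ (br _ _ a) (additive0 (br _ _ a))).
  by apply: eq_bigr => d _; rewrite coef_act eval_act.
have Pj Y (b : F Y) : P Y (tm j b).
  have [hc _] := hF.
  have j0 : P Y (tm j (0 : F Y)) by rewrite (additive0 (@tm_add _ _ _ _ j Y)).
  have jB b1 b2 : P Y (tm j b1) -> P Y (tm j b2) -> P Y (tm j (b1 - b2)).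
    by rewrite (additiveB (@tm_add _ _ _ _ j Y)); exact: PB.
  pose PF := @Subgroup (F Y) (fun c => P Y (tm j c)) j0 jB.
  suff base (p : bispan O T Y) : P Y (tm j (ioF p)).
    exact: (completion_ind (hc Y) (P := PF) base b).
  exists (\max_(c : bB p) degree c).+1 => m nm.
  have pm (c : bB p) : (degree c < m)%N.
    by apply: leq_trans nm; rewrite ltnS; exact: leq_bigmax.
  split.
    rewrite {1}j_polynomial (tmap_strata pm); apply: eq_bigr => d _.
    by rewrite coef_j strata_mapE /stratum_class (span_classE hA) burnside_unitE eval_span.
  rewrite coef_j strata_mapE /stratum_class (span_classE hA) burnside_unitE.
  apply: (@mmap_empty _ (mackey_of S)) => z.
  by have := pm (stratum_incl z); rewrite stratum_degree ltnn.
pose PS : submackey (mackey_of B) := @Submackey _ (mackey_of B)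
  (fun Z => @Subgroup (mackey_of B Z) (P Z) (P0 Z) (@PB Z)) Pm.
suff base Z Z' (b : S Z) (c : F Z') : P _ (ext_mul (tm i b) (tm j c)).
  exact: (box_ind hB (P := PS) base).
exact: Pa.
Qed.

(** The index set is the set of degrees: one free generator at each mon d. *)
Lemma free_tambara_module : is_free_module (module_of i).
Proof.
exists nat, (mon T), (fun d => N d), (fun d => eval_map i (mon_elt d)).
split=> [d|d|X W v vD].
- exact: (shift_module_free hA).
- exact: eval_module_map.
pose bound (x : B X) := projT1 (cid (decomposition x)).
have boundP (x : B X) := projT2 (cid (decomposition x)).
have v0 d : v d 0 = 0 by exact: additive0 (vD d).
pose f (x : B X) := \sum_(d < bound x) v d (mm (coef d) x).
have fE x n : (bound x <= n)%N -> f x = \sum_(d < n) v d (mm (coef d) x).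
  move=> le; rewrite /f (big_ord_widen n (fun d => v d (mm (coef d) x))) //.
  rewrite big_mkcond; apply: eq_bigr => d _; case: ltnP => // xd.
  by have [_ ->] := boundP x d xd.
have fD : {morph f : x y / x + y}.
  move=> x y; pose n := maxn (bound (x + y)) (maxn (bound x) (bound y)).
  have lx : (bound x <= n)%N by rewrite /n !leq_max leqnn orbT.
  have ly : (bound y <= n)%N by rewrite /n !leq_max leqnn !orbT.
  rewrite (fE x n) // (fE y n) // (fE (x + y) n) ?leq_maxl // -big_split.
  by apply: eq_bigr => d _; rewrite mmD vD.
exists f; split=> // [d a|f' f'D f'E x].
  set x := mm _ a; pose n := maxn (bound x) d.+1.
  have dn : (d < n)%N by rewrite leq_max leqnn orbT.
  rewrite (fE x n) ?leq_maxl // (bigD1 (Ordinal dn)) //= coef_eval.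
  rewrite big1 ?addr0 // => e ed; rewrite coef_eval_neq //.
have [e _] := boundP x _ (leqnn _).
rewrite {1}e (big_morph _ f'D (additive0 f'D)).
by apply: eq_bigr => d _; exact: f'E.
Qed.
End Decomposition.

Theorem theorem5 (G : finGroupType) (O : indexing_category G) (H : {group G})
    (A : tambara O) (ioA : forall X : gset G, gset_over X -> A X)
    (hA : is_burnside ioA)
    (S : tambara O) (l : tambara_map A S)
    (hS : is_localization (ioA (pointg G) (free_orbit G)) l)
    (F : tambara O) (ioF : forall X : gset G, bispan O (orbitg H) X -> F X)
    (hF : is_free_tambara ioF)
    (B : tambara O) (i : tambara_map S B) (j : tambara_map F B)
    (hB : is_tambara_box i j) :
  is_free_module (module_of i).
Proof.
have [[r hr] _] := hS.
rewrite (burnsideE hA) burnside_unitE in hr.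
exact: (free_tambara_module hA l hr hF hB).
Qed.
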